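(* Let $n\ge 2$, and let $V=\mathbb{C}^n$ have basis $v_1,\dots,v_n$. For $1\le d\le n$ let $pr_d:V\to V$ be the projection along $\mathbb{C}v_d$ onto the linear span of the vectors $v_i$, $i\neq d$. The image of the embedding of the complete degenerate flag variety $\mathcal{F}^a_n$ in $\prod_{d=1}^{n-1}Gr(d,n)$ is equal to the set of all collections of subspaces $(V_1,\dots,V_{n-1})$, $V_d\in Gr(d,n)$ (so $V_d\subset V$, $\dim V_d=d$), such that $$pr_{d+1}(V_d)\subset V_{d+1},\qquad 1\le d\le n-2.$$
   Context: Everything is over $\mathbb{C}$. $Gr(d,n)$ is the Grassmannian of $d$-dimensional subspaces of $V=\mathbb{C}^n$. Let $\mathfrak{g}=\mathfrak{sl}_n=\mathfrak{n}\oplus\mathfrak{h}\oplus\mathfrak{n}^-$ be the standard Cartan decomposition (strictly upper triangular, diagonal, strictly lower triangular), $\mathfrak b=\mathfrak n\oplus\mathfrak h$, $B\subset SL_n$ the Borel subgroup with Lie algebra $\mathfrak b$, $M=\dim\mathfrak{n}$. The degenerate algebra is $\mathfrak g^a=\mathfrak b\oplus(\mathfrak n^-)^a$, where $(\mathfrak n^-)^a$ is an abelian ideal equal to $\mathfrak n^-$ as a vector space, and $\mathfrak b$ acts on it via the identification $(\mathfrak n^-)^a\simeq\mathfrak g/\mathfrak b$. The corresponding group is $G^a=B\ltimes\mathbb G_a^M$, with $\mathbb G_a$ the additive group of the field and $\mathbb G_a^M$ the group of $(\mathfrak n^-)^a$. For a dominant integral weight $\lambda$ let $V_\lambda$ be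 the irreducible $\mathfrak g$-module with highest weight vector $v_\lambda$, and $F_s=\mathrm{span}\{x_1\cdots x_l v_\lambda: x_i\in\mathfrak g,\ l\le s\}$ the PBW filtration. The associated graded space $V_\lambda^a=\bigoplus_{s\ge0}F_s/F_{s-1}$ ($F_{-1}=0$) is naturally a $\mathfrak g^a$-module and a $G^a$-module: $x\in(\mathfrak n^-)^a$ acts by the induced maps $F_s/F_{s-1}\to F_{s+1}/F_s$ and $\mathfrak b$ by the induced maps $F_s/F_{s-1}\to F_s/F_{s-1}$. The degenerate flag variety is the closure $\mathcal F^a_\lambda=\overline{\mathbb G_a^M\cdot\mathbb C v_\lambda}\subset\mathbb P(V^a_\lambda)$. With $\omega_d$ the fundamental weights, put $\mathcal F^a(d_1,\dots,d_s)=\mathcal F^a_{\omega_{d_1}+\dots+\omega_{d_s}}$ for $1\le d_1<\dots<d_s\le n-1$; the complete degenerate flag variety is $\mathcal F^a_n=\mathcal F^a(1,2,\dots,n-1)$. Embedding into Grassmannians: $V_{\omega_d}=\Lambda^d V$ with basis $v_J=v_{j_1}\wedge\dots\wedge v_{j_d}$, $J=\{j_1<\dots<j_d\}$ and highest weight vector $v_1\wedge\dots\wedge v_d$; the vector $v_J$ lies in PBW degree $\#\{j\in J:j>d\}$, and $V^a_{\omega_d}$ is identified with $\Lambda^dV$ by identifying the class of $v_J$ with $v_J$. Under this identification $\mathcal F^a_{\omega_d}=Gr(d,n)\subset\mathbb P(\Lambda^dV)$ (Plücker embedding). For all dominant $\lambda,\mu$ there is an embedding of $G^a$-modules $V^a_{\lambda+\mu}\hookrightarrow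 V^a_\lambda\otimes V^a_\mu$ sending $v_{\lambda+\mu}$ to $v_\lambda\otimes v_\mu$, which induces an embedding $\mathcal F^a_{\lambda+\mu}\hookrightarrow\mathcal F^a_\lambda\times\mathcal F^a_\mu$. Iterating gives the embedding $\mathcal F^a(d_1,\dots,d_s)\hookrightarrow\prod_{i=1}^sGr(d_i,n)$. *)

(* Defs.v *)
From HB Require Import structures.
From mathcomp Require Import all_boot all_order all_algebra.
From mathcomp Require Import complex mpoly.
From mathcomp Require Import classical_sets reals.

Set Implicit Arguments.
Unset Strict Implicit.
Unset Printing Implicit Defensive.

Import GRing.Theory.
Local Open Scope ring_scope.

(* The space C^n is 'cV_n, and sl_n is the set of x : 'M_n with \tr x = 0.   *)
(* The Lie algebras sl_n and its degeneration sl_n^a have the same           *)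
(* underlying vector space. Their actions are given as linear maps on all of *)
(* 'M_n, whose values matter only on traceless matrices: a linear map on     *)
(* sl_n extends to 'M_n.                                                     *)

Section LieAlgebra.

Variables (K : fieldType) (n : nat).

Definition b_part (x : 'M[K]_n) : 'M[K]_n :=
  \matrix_(i, j) (if (i <= j)%N then x i j else 0).

Definition nminus_part (x : 'M[K]_n) : 'M[K]_n :=
  \matrix_(i, j) (if (j < i)%N then x i j else 0).

Definition strictly_upper (x : 'M[K]_n) : Prop :=
  forall i j : 'I_n, (j <= i)%N -> x i j = 0.

Definition strictly_lower (x : 'M[K]_n) : Prop :=
  forall i j : 'I_n, (i <= j)%N -> x i j = 0.

Definition fundamental_weight (d : nat) (h : 'M[K]_n) : K :=
  \sum_(i < n | (i < d)%N) h i i.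

(* omega_1 + ... + omega_(n-1) *)
Definition complete_weight (h : 'M[K]_n) : K :=
  \sum_(k < n.-1) fundamental_weight k.+1 h.

End LieAlgebra.

Section HighestWeightModule.

Variables (K : fieldType) (n : nat) (V : vectType K).
Variables (rho : {linear 'M[K]_n -> 'End(V)}) (v : V).

Definition is_sl_rep : Prop :=
  forall x y : 'M[K]_n, \tr x = 0 -> \tr y = 0 -> forall w : V,
    rho (x *m y - y *m x) w = rho x (rho y w) - rho y (rho x w).

Definition is_irreducible : Prop :=
  (exists w : V, w != 0) /\
  forall W : {vspace V},
    (forall x : 'M[K]_n, \tr x = 0 -> (rho x @: W <= W)%VS) ->
    W = 0%VS \/ W = fullv.

Definition is_highest_weight_vector (lam : 'M[K]_n -> K) : Prop :=
  [/\ v != 0,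
      forall x : 'M[K]_n, strictly_upper x -> rho x v = 0
    & forall h : 'M[K]_n, is_diag_mx h -> \tr h = 0 -> rho h v = lam h *: v].

Definition irreducible_highest_weight (lam : 'M[K]_n -> K) : Prop :=
  [/\ is_sl_rep, is_irreducible & is_highest_weight_vector lam].

Definition word_act (xs : seq 'M[K]_n) : V := foldr (fun x w => rho x w) v xs.

(* w \in F_s *)
Definition pbw (s : nat) (w : V) : Prop :=
  exists2 ws : seq (seq 'M[K]_n),
    (forall xs, xs \in ws ->
       (size xs <= s)%N /\ (forall x, x \in xs -> \tr x = 0))
    & w \in <<[seq word_act xs | xs <- ws]>>%VS.

(* w \in F_(s-1), where F_(-1) = 0 *)
Definition pbw_pred (s : nat) (w : V) : Prop :=
  if s is t.+1 then pbw t w else w = 0.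

(* Va is the direct sum of the F_s / F_(s-1), where [cls s] restricted to    *)
(* F_s is the quotient map onto F_s / F_(s-1), seen inside Va. The action of *)
(* sl_n^a on Va is the induced one, in which the part of x in b preserves    *)
(* the degree and the part of x in n^- raises it by one.                     *)
Record is_pbw_degeneration (Va : vectType K) (cls : nat -> 'Hom(V, Va))
    (act : {linear 'M[K]_n -> 'End(Va)}) : Prop := IsPbwDegeneration {
  pbw_cls_eq0 : forall (s : nat) (w : V),
    pbw s w -> (cls s w = 0 <-> pbw_pred s w);
  pbw_cls_direct : forall (N : nat) (w : nat -> V),
    (forall s, pbw s (w s)) -> \sum_(s < N) cls s (w s) = 0 ->
    forall s, (s < N)%N -> cls s (w s) = 0;
  pbw_cls_span : forall u : Va, exists (N : nat) (w : nat -> V),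
    (forall s, pbw s (w s)) /\ u = \sum_(s < N) cls s (w s);
  pbw_actE : forall (x : 'M[K]_n) (s : nat) (w : V),
    \tr x = 0 -> pbw s w ->
    act x (cls s w) =
      cls s (rho (b_part x) w) + cls s.+1 (rho (nminus_part x) w)
}.

End HighestWeightModule.

Section DegenerateFlagVariety.

Variables (K : fieldType) (n : nat).

(* Subsets of a projective space P(W) are represented by the sets of nonzero *)
(* vectors of W that span their points.                                      *)

Definition zariski_closure (W : vectType K) (S : set W) : set W :=
  let coords (u : W) (i : 'I_(\dim {:W})) := coord (vbasis {:W}) i u in
  [set u | u != 0 /\
     forall (e : nat) (p : {mpoly K[\dim {:W}]}), p \is e.-homog ->
       (forall w, S w -> p.@[coords w] = 0) -> p.@[coords u] = 0]%classic.

(* On a nilpotent endomorphism A of W this is the exponential, because       *)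
(* A ^ (\dim W) = 0.                                                         *)
Definition nilp_exp (W : vectType K) (A : 'End(W)) (u : W) : W :=
  \sum_(k < (\dim {:W}).+1) (k`!%:R)^-1 *: iter k A u.

(* The orbit of the line through [u0] under G_a^M = exp((n^-)^a). *)
Definition Ga_orbit (Va : vectType K) (act : {linear 'M[K]_n -> 'End(Va)})
    (u0 : Va) : set Va :=
  [set u | exists y : 'M[K]_n, strictly_lower y /\
     exists2 c : K, c != 0 & u = c *: nilp_exp (act y) u0]%classic.

Definition degenerate_flag_variety (Va : vectType K)
    (act : {linear 'M[K]_n -> 'End(Va)}) (u0 : Va) : set Va :=
  zariski_closure (Ga_orbit act u0).

End DegenerateFlagVariety.

Section ExteriorPower.

Variables (K : fieldType) (n d : nat).

(* The d-subsets j_1 < ... < j_d of the index set, as increasing maps. *)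
Definition dsub : Type :=
  {J : {ffun 'I_d -> 'I_n} |
     [forall a : 'I_d, forall b : 'I_d, (a < b)%N ==> (J a < J b)%N]}.
HB.instance Definition _ := Finite.on dsub.

(* The d-th exterior power of C^n, by coordinates in the basis v_J. *)
Definition ext : Type := {ffun dsub -> K^o}.
HB.instance Definition _ := Vector.on ext.

Definition ext_basis (J : dsub) : ext := [ffun L => (L == J)%:R].

(* w_1 /\ ... /\ w_d for the columns w_1, ..., w_d of W: the coordinate at   *)
(* v_J is the minor of W on the rows j_1, ..., j_d.                          *)
Definition wedge (W : 'M[K]_(n, d)) : ext :=
  [ffun J : dsub => \det (rowsub (val J) W)].

Definition ext_act_basis (x : 'M[K]_n) (J : dsub) : ext :=
  let W : 'M[K]_(n, d) := colsub (val J) 1%:M in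
  \sum_(a < d) wedge (\matrix_(i, b) (if b == a then (x *m W) i b else W i b)).

Definition ext_act (x : 'M[K]_n) (t : ext) : ext :=
  \sum_(J : dsub) t J *: ext_act_basis x J.

Definition ext_hw : ext :=
  wedge (\matrix_(i, a) ((i : nat) == a)%:R).

(* #{j in J | j > d} for indices j counted from 1, which is the PBW degree   *)
(* of v_J.                                                                   *)
Definition ext_deg (J : dsub) : nat := #|[set a : 'I_d | (d <= val J a)%N]|.

(* The quotient map F_s -> F_s / F_(s-1), with the class of v_J written v_J. *)
Definition ext_cls (s : nat) (t : ext) : ext :=
  [ffun J : dsub => if ext_deg J == s then t J else 0].

(* The induced action of sl_n^a. *)
Definition ext_gact (x : 'M[K]_n) (t : ext) : ext :=
  \sum_(J : dsub) t J *:
    (ext_cls (ext_deg J) (ext_act (b_part x) (ext_basis J)) +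
     ext_cls (ext_deg J).+1 (ext_act (nminus_part x) (ext_basis J))).

(* For a subspace of dimension d, a representative of its Pluecker point. *)
Definition plucker (U : {vspace 'cV[K]_n}) : ext :=
  wedge (\matrix_(i, a) (vbasis U)`_a i 0).

End ExteriorPower.

Section Embedding.

Variables (K : fieldType) (n : nat).

(* Here and below k : 'I_n.-1 stands for the dimension d = k.+1.             *)
(* The tensor product of the exterior powers of degrees 1, ..., n - 1, by    *)
(* coordinates in the basis v_{J_1} (x) ... (x) v_{J_(n-1)}.                 *)
Definition multi_dsub : Type := {dffun forall k : 'I_n.-1, dsub n k.+1}.
HB.instance Definition _ := Finite.on multi_dsub.

Definition tens : Type := {ffun multi_dsub -> K^o}.
HB.instance Definition _ := Vector.on tens.

Definition ptens (t : forall k : 'I_n.-1, ext K n k.+1) : tens :=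
  [ffun J : multi_dsub => \prod_(k < n.-1) t k (J k)].

(* sum_k 1 (x) ... (x) A_k (x) ... (x) 1 *)
Definition tens_act (A : forall k : 'I_n.-1, ext K n k.+1 -> ext K n k.+1)
    (T : tens) : tens :=
  \sum_(J : multi_dsub) T J *: \sum_(k < n.-1)
    ptens (fun l => if l == k then A l (ext_basis K (J l))
                    else ext_basis K (J l)).

Definition is_ga_embedding (Va : vectType K)
    (act : {linear 'M[K]_n -> 'End(Va)}) (u0 : Va)
    (iota : {linear Va -> tens}) : Prop :=
  [/\ injective iota,
      iota u0 = ptens (fun k => ext_hw K n k.+1)
    & forall x : 'M[K]_n, \tr x = 0 -> forall u : Va,
        iota (act x u) = tens_act (fun k => ext_gact x) (iota u)].

(* The image in the product of the Gr(d, n) of the map that iota induces on  *)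
(* the degenerate flag variety.                                              *)
Definition flag_image (Va : vectType K)
    (act : {linear 'M[K]_n -> 'End(Va)}) (u0 : Va)
    (iota : {linear Va -> tens}) : set ('I_n.-1 -> {vspace 'cV[K]_n}) :=
  [set U | (forall k : 'I_n.-1, \dim (U k) = k.+1) /\
     exists2 u : Va, degenerate_flag_variety act u0 u &
       exists2 c : K, c != 0 &
         iota u = c *: ptens (fun k => plucker k.+1 (U k))]%classic.

(* The projection along v_d onto the span of the other basis vectors, with d *)
(* counted from 1.                                                           *)
Definition pr (d : nat) : 'End('cV[K]_n) :=
  linfun (mulmx (\matrix_(i < n, j < n) ((i == j) && (i.+1 != d))%:R)).

End Embedding.

(* Main.v *)
(** The orbit of [exp y] consists of the tuples of column spaces of the matrices
    [1; Y_d], where [Y_d] is the lower left [(n - d) x d] block of [y].  Each of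
    these tuples satisfies the incidence conditions, and the conditions are linear
    in the tensor product of the Pluecker vectors, so they hold on the closure.

    Conversely, let [(V_d)] be incident.  There are bases of the [V_d], the columns
    of [A_d], such that the first [d] rows of [A_d] form an upper triangular matrix
    and [pr_(d+1) A_d = A_(d+1) u_d] with [u_d] upper triangular.  Let
    [m = n - 1], let [J] be the matrix with ones on its diagonal, and replace
    [u_d] by [u_d + t J] and [A_m] by [A_m + t J].  For [d < m], all rows of
    [A_d(t)] but the row [d + 1], which is kept, are then forced by
    [pr_(d+1) A_d(t) = A_(d+1)(t) (u_d + t J)], and triangularity makes the result
    incident for every [t].  For almost all [t] the diagonal entries of [A_d(t)]
    are nonzero, and then the tuple lies in the orbit; at [t = 0] it is [(V_d)]. *)
Require Import Defs.
From HB Require Import structures.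
From mathcomp Require Import all_boot all_order all_fingroup all_algebra ring.
From mathcomp Require Import complex mpoly.
From mathcomp Require Import classical_sets reals boolp.

Set Implicit Arguments.
Unset Strict Implicit.
Unset Printing Implicit Defensive.

Import GRing.Theory.
Local Open Scope ring_scope.

(** * Minors and the adjugate *)

Section Minors.

Variable R : comNzRingType.

(** The cofactors along row [b] do not involve that row, so Laplace expansion along it pairs the row
    of [N] with cofactors of [M]. *)
Lemma det_row_repl d (M N : 'M[R]_d) (b : 'I_d) :
  \det (\matrix_(i, j) (if i == b then N i j else M i j)) = (N *m \adj M) b b.
Proof.
rewrite (expand_det_row _ b) mxE; apply: eq_bigr => j _.
rewrite !mxE eqxx; congr (_ * (_ * \det _)).
by apply/matrixP=> i k; rewrite !mxE eq_sym (negPf (neq_lift _ _)).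
Qed.

Lemma det_col_repl d (M N : 'M[R]_d) (b : 'I_d) :
  \det (\matrix_(i, j) (if j == b then N i j else M i j)) = (\adj M *m N) b b.
Proof.
rewrite (expand_det_col _ b) mxE; apply: eq_bigr => j _.
rewrite !mxE eqxx mulrC; congr ((_ * \det _) * _).
by apply/matrixP=> i k; rewrite !mxE eq_sym (negPf (neq_lift _ _)).
Qed.

Definition upd (I : eqType) T (f : I -> T) (b : I) (i : T) (a : I) : T :=
  if a == b then i else f a.

(** Cramer's rule: a minor is linear in the row that is exchanged, so all the exchanged minors are
    entries of one product with an adjugate. *)
Lemma det_rowsub_upd n d (f : 'I_d -> 'I_n) (b : 'I_d) (i : 'I_n)
    (W : 'M[R]_(n, d)) :
  \det (rowsub (upd f b i) W) = (W *m \adj (rowsub f W)) i b.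
Proof.
transitivity ((rowsub (fun=> i) W *m \adj (rowsub f W)) b b).
  rewrite -det_row_repl; congr (\det _); apply/matrixP=> a j.
  by rewrite !mxE /upd; case: eqP.
by rewrite mul_rowsub_mx mxE.
Qed.

Lemma tr_rowsub_adj n d (f : 'I_d -> 'I_n) (X : 'M[R]_n) (W : 'M[R]_(n, d)) :
  \tr (rowsub f (X *m W) *m \adj (rowsub f W)) =
  \sum_b \sum_i X (f b) i * \det (rowsub (upd f b i) W).
Proof.
apply: eq_bigr => b _.
rewrite -mul_rowsub_mx -mulmxA mul_rowsub_mx !mxE; apply: eq_bigr => i _.
by rewrite det_rowsub_upd.
Qed.

End Minors.

Section Derivative.

Variable R : comNzRingType.

Lemma derivE_prod (I : finType) (F : I -> {poly R}) :
  (\prod_i F i)^`() = \sum_k \prod_i (if i == k then (F i)^`() else F i).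
Proof.
suff H (r : seq I) : uniq r ->
    (\prod_(i <- r) F i)^`() =
    \sum_(k <- r) \prod_(i <- r) (if i == k then (F i)^`() else F i).
  by apply: H; apply: index_enum_uniq.
elim: r => [|a r IH] /=; first by rewrite !big_nil derivC.
case/andP=> ar ur; rewrite !big_cons derivM IH // eqxx.
have aE k : k \in r -> (a == k) = false by move=> kr; apply: contraNF ar => /eqP->.
congr (_ * _ + _).
  by apply: eq_big_seq => i /aE; rewrite eq_sym => ->.
rewrite mulr_sumr; apply: eq_big_seq => k /aE ak.
by rewrite big_cons ak.
Qed.

(** Jacobi's formula, obtained by differentiating the Leibniz expansion one row at a time. *)
Lemma deriv_det d (M : 'M[{poly R}]_d) :
  (\det M)^`() = \tr (map_mx (@deriv R) M *m \adj M).
Proof.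
rewrite /mxtrace; under [RHS]eq_bigr => b _ do rewrite -det_row_repl.
rewrite /determinant linear_sum exchange_big /=; apply: eq_bigr => s _.
rewrite -mulr_sumr -signr_odd; case: (odd _);
  rewrite ?expr0 ?expr1 ?mulN1r ?mul1r ?derivN derivE_prod; last first.
  by apply: eq_bigr => k _; apply: eq_bigr => i _; rewrite !mxE.
congr (- _).
by apply: eq_bigr => k _; apply: eq_bigr => i _; rewrite !mxE.
Qed.

End Derivative.

Section Distributivity.

Variable R : comNzRingType.

(** The components of a multi-index have types depending on the position, so distributivity is
    needed over dependent functions; it is transported from [fprod]. *)
Lemma prod_sum_dffun (I : finType) (T : I -> finType) (F : forall i, T i -> R) :
  \prod_i \sum_(j : T i) F i j =
  \sum_(f : {dffun forall i : I, T i}) \prod_i F i (f i).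
Proof.
rewrite (reindex (@dffun_of_fprod I T)) /=; last exact/onW_bij/dffun_of_fprod_bij.
transitivity (\sum_(t : fprod T) \prod_(i in I) [ffun j => F i j] (t i)); last first.
  by apply: eq_bigr => t _; apply: eq_bigr => i _; rewrite !ffunE.
rewrite big_fprod; rewrite -(bigA_distr_big_dep (fun i => [pred x | tag x == i])
  (fun i => untag 0 [ffun j => F i j])) /=.
apply: eq_bigr => i _.
rewrite -(big_tag (fun i => [ffun j => F i j])).
by apply: eq_bigr => j _; rewrite ffunE.
Qed.

End Distributivity.

(** * Increasing index maps and minors on arbitrary rows *)

Section Dsub.

Variables n d : nat.
Implicit Types J L : dsub n d.

Lemma dsub_lt J (a b : 'I_d) : (a < b)%N -> (val J a < val J b)%N.
Proof. by move=> ab; have /forallP/(_ a)/forallP/(_ b)/implyP/(_ ab) := valP J. Qed.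

Lemma dsub_inj J : injective (val J).
Proof.
move=> a b e; apply: val_inj; case: (ltngtP a b) => // /(dsub_lt J);
  by rewrite e ltnn.
Qed.

(** [s] is injective, hence a permutation, so both maps list the same set, and a strictly increasing
    listing is unique. *)
Lemma dsub_image_inj J L (s : 'I_d -> 'I_d) :
  (forall a, val J a = val L (s a)) -> J = L.
Proof.
move=> JL; have s_inj : injective s.
  by move=> a b e; apply: (@dsub_inj J); rewrite !JL e.
have sorted_dsub (M : dsub n d) :
    sorted ltn [seq (val M a : nat) | a <- enum 'I_d].
  apply: (@homo_sorted _ _ _ (fun a b : 'I_d => (a < b)%N)).
    by move=> a b; apply: dsub_lt.
  by rewrite -(@sorted_map _ _ _ ltn) val_enum_ord iota_ltn_sorted.
have /eq_in_map e : [seq (val J a : nat) | a <- enum 'I_d] =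
         [seq (val L a : nat) | a <- enum 'I_d].
  apply: (irr_sorted_eq ltn_trans ltnn (sorted_dsub J) (sorted_dsub L)) => x.
  apply/mapP/mapP => -[a _ ->].
    by exists (s a); rewrite ?mem_enum ?JL.
  exists (invF s_inj a); first by rewrite mem_enum.
  by rewrite JL f_invF.
by apply/val_inj/ffunP => a; apply/val_inj/e; rewrite mem_enum.
Qed.

(** The permutation sends [a] to the rank of [f a] among the values of [f]. *)
Lemma dsub_sort (f : 'I_d -> 'I_n) : injective f ->
  exists J, exists s : 'S_d, forall a, f a = val J (s a).
Proof.
move=> f_inj.
have rkP (a : 'I_d) : (#|[set b | (f b < f a)%N]| < d)%N.
  rewrite -[X in (_ < X)%N]card_ord -cardsT; apply: proper_card.
  by apply/properP; split; [exact: finset.subsetT | exists a; rewrite !inE ?ltnn].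
pose rk a := Ordinal (rkP a).
have rk_lt a b : (f a < f b)%N -> (rk a < rk b)%N.
  move=> ab; apply: proper_card; apply/properP; split.
    by apply/fintype.subsetP => c; rewrite !inE => /ltn_trans; apply.
  by exists a; rewrite !inE ?ltnn.
have rk_inj : injective rk.
  move=> a b e; apply/f_inj/val_inj; case: (ltngtP (f a) (f b)) => // /rk_lt;
  by rewrite e ltnn.
pose s := perm rk_inj; pose g := [ffun c => f ((s^-1)%g c)].
have P : [forall a : 'I_d, forall b : 'I_d, (a < b)%N ==> (g a < g b)%N].
  apply/forallP => a; apply/forallP => b; apply/implyP => ab; rewrite !ffunE.
  case: (ltngtP (f _) (f _)) => // [/rk_lt|/val_inj/f_inj/perm_inj e].
    by rewrite -![rk _](permE rk_inj) -/s !permKV ltnNge ltnW.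
  by rewrite e ltnn in ab.
by exists (exist _ g P), s => a; rewrite ffunE permK.
Qed.

End Dsub.

Section Expansion.

Variable R : comNzRingType.

Definition dsub_mx n d (J : dsub n d) : 'M[R]_(n, d) := colsub (val J) 1%:M.

Lemma det_rowsub_dsub_mx n d (f : 'I_d -> 'I_n) (J : dsub n d) :
  \det (rowsub f (dsub_mx J)) != 0 ->
  exists s : 'S_d, forall a, f a = val J (s a).
Proof.
move=> D0; have [/existsP[s /forallP sP]|no] :=
  boolP [exists s : 'S_d, forall a, f a == val J (s a)].
  by exists s => a; apply/eqP.
case/eqP: D0; rewrite /determinant big1 // => s _.
move: no; rewrite negb_exists => /forallP/(_ s); rewrite negb_forall.
by case/existsP=> a /negPf fa; rewrite (bigD1 a) //= !mxE fa mul0r mulr0.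
Qed.

(** At most one term survives, the sorted version of [f], with the sign of the sorting permutation.
    The coefficients do not depend on [W], so minors on arbitrary rows are linear forms in the
    Pluecker coordinates. *)
Lemma det_rowsub_expand n d (f : 'I_d -> 'I_n) (W : 'M[R]_(n, d)) :
  \det (rowsub f W) =
  \sum_(J : dsub n d) \det (rowsub f (dsub_mx J)) * \det (rowsub (val J) W).
Proof.
have [/injectiveP f_inj|/injectivePn[a [b ab fab]]] := boolP (injectiveb f); last first.
  have D0 (A : 'M[R]_(n, d)) : \det (rowsub f A) = 0.
    by apply: (determinant_alternate ab) => j; rewrite !mxE fab.
  by rewrite D0 big1 // => J _; rewrite D0 mul0r.
have [J0 [s fE]] := dsub_sort f_inj.
have DE (A : 'M[R]_(n, d)) : \det (rowsub f A) = (-1) ^+ s * \det (rowsub (val J0) A).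
  rewrite -det_perm -det_mulmx -row_permE; congr (\det _).
  by apply/matrixP=> a j; rewrite !mxE fE.
rewrite DE (bigD1 J0) //= big1 ?addr0 => [|J JJ0].
  rewrite DE; have -> : rowsub (val J0) (dsub_mx J0) = 1%:M.
    by apply/matrixP=> a b; rewrite !mxE (inj_eq (@dsub_inj _ _ J0)).
  by rewrite det1 mulr1.
have [->|/det_rowsub_dsub_mx[s' fE']] := eqVneq (\det (rowsub f (dsub_mx J))) 0.
  by rewrite mul0r.
case/eqP: JJ0; symmetry; apply: (@dsub_image_inj _ _ _ _ (fun a => s' ((s^-1)%g a))) => a.
by rewrite -fE' fE permKV.
Qed.

End Expansion.

(** * The orbit *)

(* [nilp_exp] stops at the power [\dim W]. *)
Lemma iter_nilpotent (K : fieldType) (W : vectType K) (A : 'End(W)) (u : W) N m :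
  iter N A u = 0 -> (\dim {:W} <= m)%N -> iter m A u = 0.
Proof.
move=> uN.
have iterD0 p q : iter p A u = 0 -> (p <= q)%N -> iter q A u = 0.
  by move=> e /subnK <-; rewrite iterD e; elim: (_ - _)%N => //= k ->; rewrite linear0.
(* [r] is the least exponent with [A ^ r u = 0]; the iterates below it turn out to be free, whence
   [r <= \dim W]. *)
have [r /eqP r0 rmin] :=
  @ex_minnP (fun k => iter k A u == 0) (ex_intro _ N (introT eqP uN)).
move=> dm; apply: (iterD0 r) => //; apply: leq_trans dm.
pose X := [tuple iter i A u | i < r].
suff : free X by rewrite /free size_tuple => /eqP <-; apply/dimvS/subvf.
have XE (i : 'I_r) : X`_i = iter i A u by rewrite -tnth_nth tnth_mktuple.
apply/freeP => c c0 i; have [k] := ubnP (val i); elim: k i => // k IH i.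
rewrite ltnS => ik.
(* Applying [A ^ (r - 1 - i)] to the relation kills the terms beyond [i], and those before [i] have
   zero coefficients by induction. What remains is [c i] times the nonzero vector
   [A ^ (r - 1) u]. *)
have : iter (r.-1 - i) A (\sum_j c j *: X`_j) = 0.
  by rewrite c0; elim: (_ - _)%N => //= p ->; rewrite linear0.
have -> : iter (r.-1 - i) A (\sum_j c j *: X`_j) =
          \sum_j c j *: iter (r.-1 - i + j) A u.
  elim: (_ - _)%N => [|p /= ->]; first by apply: eq_bigr => j _; rewrite XE.
  by rewrite linear_sum; apply: eq_bigr => j _; rewrite linearZ.
have r_gt0 : (0 < r)%N := leq_ltn_trans (leq0n _) (ltn_ord i).
have i_le : (i <= r.-1)%N by rewrite -ltnS prednK.
rewrite (bigD1 i) //= subnK // big1 => [|j ji].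
  rewrite addr0 => /eqP; rewrite scaler_eq0 => /orP[/eqP//|/rmin].
  by rewrite leqNgt prednK ?leqnn.
have [ltji|ltij|e] := ltngtP j i.
- by rewrite IH ?scale0r // (leq_trans ltji).
- rewrite (iterD0 r) ?scaler0 // -[X in (X <= _)%N](prednK r_gt0).
  by rewrite -[X in (X < _)%N](subnK i_le) ltn_add2l.
- by rewrite (val_inj e) eqxx in ji.
Qed.

(** * The degenerate action on an exterior power *)

Section ExteriorAction.

Variables (K : fieldType) (n d : nat).
Implicit Types (x y : 'M[K]_n) (J L : dsub n d).

(** The Leibniz rule changes one column at a time, which gives [\adj M *m N] by Cramer; cyclicity of
    the trace turns this into changes of one row at a time. *)
Lemma ext_act_basisE x J L :
  ext_act_basis x J L =
  \tr (rowsub (val L) (x *m dsub_mx K J) *m \adj (rowsub (val L) (dsub_mx K J))).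
Proof.
rewrite mxtrace_mulC /ext_act_basis sum_ffunE; apply: eq_bigr => a _.
rewrite ffunE -det_col_repl; congr (\det _); apply/matrixP=> i b.
by rewrite !mxE; case: ifP => // _; rewrite !mxE.
Qed.

Lemma ext_act_basis_vector x J : ext_act x (ext_basis K J) = ext_act_basis x J.
Proof.
rewrite /ext_act (bigD1 J) //= ffunE eqxx scale1r big1 ?addr0 // => L /negPf LJ.
by rewrite ffunE LJ scale0r.
Qed.

(** The block of [y] that carries indices below [d] to indices at least [d], which is the part that
    raises the PBW degree in the [d]-th exterior power. *)
Definition cut (y : 'M[K]_n) : 'M[K]_n :=
  \matrix_(i, j) (if (j < d <= i)%N then y i j else 0).

(** A nonzero minor forces [L] with its entry [b] replaced by [i] to be a rearrangement of [J], so
    the two degrees differ only through that entry. *)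
Lemma ext_deg_upd J L (b : 'I_d) (i : 'I_n) :
  \det (rowsub (upd (val L) b i) (dsub_mx K J)) != 0 ->
  (ext_deg J + (d <= val L b) = ext_deg L + (d <= i))%N.
Proof.
move=> /det_rowsub_dsub_mx [s sE].
have -> : ext_deg J = #|[set a : 'I_d | (d <= upd (val L) b i a)%N]|.
  rewrite /ext_deg -(card_imset _ (@perm_inj _ (s^-1)%g)); congr #|pred_of_set _|.
  apply/setP => a; rewrite !inE sE; apply/imsetP/idP => [[c]|sa].
    by rewrite inE => ? ->; rewrite permKV.
  by exists (s a); rewrite ?inE ?permK.
rewrite /ext_deg -!sum1_card [X in (X + _)%N]big_mkcond [X in _ = (X + _)%N]big_mkcond /=.
rewrite (bigD1 b) //= [X in _ = (X + _)%N](bigD1 b) //= !inE /upd eqxx.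
rewrite addnAC [RHS]addnAC; congr (_ + _)%N.
  by rewrite addnC; do 2!case: leq.
by apply: eq_bigr => a /negPf ab; rewrite !inE ab.
Qed.

(** By [ext_deg_upd], an exchange raises the degree by exactly one only through an entry of [cut y],
    so the degenerate action of [y] is the ordinary action of this block. *)
Lemma ext_gact_basisE y J L : strictly_lower y ->
  ext_gact y (ext_basis K J) L =
  \tr (rowsub (val L) (cut y *m dsub_mx K J) *m \adj (rowsub (val L) (dsub_mx K J))).
Proof.
move=> ylow; have -> : ext_gact y (ext_basis K J) =
    ext_cls (ext_deg J).+1 (ext_act_basis y J).
  rewrite /ext_gact (bigD1 J) //= ffunE eqxx scale1r big1 ?addr0; last first.
    by move=> M /negPf MJ; rewrite ffunE MJ scale0r.
  have -> : b_part y = 0.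
    by apply/matrixP=> i j; rewrite !mxE; case: ifP => // /ylow.
  have -> : nminus_part y = y.
    apply/matrixP=> i j; rewrite !mxE; case: ltnP => // /ylow -> //.
  rewrite !ext_act_basis_vector [X in X + _](_ : _ = 0) ?add0r //.
  apply/ffunP=> M; rewrite !ffunE ext_act_basisE mul0mx.
  have -> : rowsub (val M) 0 = 0 :> 'M[K]_d by apply/matrixP=> i j; rewrite !mxE.
  by rewrite mul0mx mxtrace0; case: ifP.
rewrite ffunE ext_act_basisE !tr_rowsub_adj.
case: eqP => [e|ne].
  apply: eq_bigr => b _; apply: eq_bigr => i _.
  have [->|/ext_deg_upd e'] := eqVneq (\det (rowsub (upd (val L) b i) (dsub_mx K J))) 0.
    by rewrite !mulr0.
  suff idb : (i < d <= val L b)%N by rewrite mxE idb.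
  move: e'; rewrite e addSnnS => /addnI; rewrite ltnNge.
  by case: (d <= i)%N; case: (d <= val L b)%N.
symmetry; rewrite big1 // => b _; rewrite big1 // => i _.
have [->|/ext_deg_upd e'] := eqVneq (\det (rowsub (upd (val L) b i) (dsub_mx K J))) 0.
  by rewrite mulr0.
rewrite mxE; case: ifP => [/andP[id db]|]; last by rewrite mul0r.
by case: ne; move: e'; rewrite db leqNgt id /= addn0 addn1.
Qed.

Definition flag_mx (R : nzRingType) : 'M[R]_(n, d) :=
  \matrix_(i, a) ((i : nat) == a)%:R.

Definition cell_mx y : 'M[K]_(n, d) := flag_mx K + cut y *m flag_mx K.

(** Since [cut y] squares to zero, this is [exp (s * cut y)] applied to the first [d] basis vectors,
    with [s] the polynomial variable. *)
Definition cell_poly_mx y : 'M[{poly K}]_(n, d) :=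
  map_mx polyC (flag_mx K) + 'X *: map_mx polyC (cut y *m flag_mx K).

Lemma cut_mul_cut y : cut y *m cut y = 0.
Proof.
apply/matrixP=> i j; rewrite !mxE big1 // => k _; rewrite !mxE.
case: ifP => [/andP[kd _]|_]; last by rewrite mul0r.
by rewrite [(d <= k)%N]leqNgt kd andbF mulr0.
Qed.

Lemma deriv_cell_poly_mx y :
  map_mx (@deriv K) (cell_poly_mx y) = map_mx polyC (cut y) *m cell_poly_mx y.
Proof.
rewrite mulmxDr -scalemxAr -!map_mxM mulmxA cut_mul_cut mul0mx map_mx0 scaler0 addr0.
by apply/matrixP=> i j; rewrite !mxE derivD derivM !derivC derivX mulr0 addr0 mul1r add0r.
Qed.

(* The differential equation of the exponential: [cell_poly_mx y] at [s] spans
   the [d]-dimensional component of [exp (s y)]. *)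
Lemma deriv_cell_minor y L : strictly_lower y ->
  (\det (rowsub (val L) (cell_poly_mx y)))^`() =
  \sum_J (ext_gact y (ext_basis K J) L)%:P * \det (rowsub (val J) (cell_poly_mx y)).
Proof.
move=> ylow; rewrite deriv_det map_mxsub deriv_cell_poly_mx tr_rowsub_adj.
under [RHS]eq_bigr => J _ do rewrite (ext_gact_basisE _ _ ylow) tr_rowsub_adj.
transitivity (\sum_b \sum_i \sum_J (cut y (val L b) i *
   \det (rowsub (upd (val L) b i) (dsub_mx K J)))%:P * \det (rowsub (val J) (cell_poly_mx y))).
  apply: eq_bigr => b _; apply: eq_bigr => i _.
  rewrite det_rowsub_expand mulr_sumr; apply: eq_bigr => J _.
  rewrite mulrA mxE polyCM; congr (_ * _ * _).
  rewrite -det_map_mx; congr (\det _).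
  by apply/matrixP=> a c; rewrite !mxE rmorph_nat.
under [LHS]eq_bigr => b _ do rewrite exchange_big /=.
rewrite exchange_big; apply: eq_bigr => J _.
rewrite rmorph_sum mulr_suml; apply: eq_bigr => b _.
by rewrite rmorph_sum mulr_suml.
Qed.

End ExteriorAction.

(** * The exponential orbit inside the tensor product *)

Section TensorAction.

Variables (K : numFieldType) (n : nat) (y : 'M[K]_n).
Hypothesis ylow : strictly_lower y.

Definition tens_act_coef (L J : multi_dsub n) : K :=
  \sum_(k < n.-1) \prod_(l < n.-1)
    (if l == k then ext_gact y (ext_basis K (J l)) (L l) else (L l == J l)%:R).

Lemma tens_act_coefE (T : tens K n) L :
  tens_act (fun k => ext_gact y) T L = \sum_J T J * tens_act_coef L J.
Proof.
rewrite /tens_act sum_ffunE; apply: eq_bigr => J _.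
rewrite ffunE; congr (_ * _); rewrite sum_ffunE; apply: eq_bigr => k _.
rewrite ffunE; apply: eq_bigr => l _; case: ifP => // _.
by rewrite ffunE.
Qed.

Definition cell_poly (L : multi_dsub n) : {poly K} :=
  \prod_(k < n.-1) \det (rowsub (val (L k)) (cell_poly_mx k.+1 y)).

(** The product rule over the tensor factors matches the Leibniz form of [tens_act]. *)
Lemma deriv_cell_poly L :
  (cell_poly L)^`() = \sum_J (tens_act_coef L J)%:P * cell_poly J.
Proof.
rewrite derivE_prod.
transitivity (\sum_k \sum_(J : multi_dsub n) \prod_(l < n.-1)
  ((if l == k then ext_gact y (ext_basis K (J l)) (L l) else (L l == J l)%:R)%:P *
   \det (rowsub (val (J l)) (cell_poly_mx l.+1 y)))).
  apply: eq_bigr => k _.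
  rewrite -(prod_sum_dffun (fun (l : 'I_n.-1) (j : dsub n l.+1) =>
     (if l == k then ext_gact y (ext_basis K j) (L l) else (L l == j)%:R)%:P *
   \det (rowsub (val j) (cell_poly_mx l.+1 y)))).
  apply: eq_bigr => l _; case: ifP => _; first exact: deriv_cell_minor.
  rewrite (bigD1 (L l)) //= eqxx mul1r big1 ?addr0 // => j /negPf jL.
  by rewrite eq_sym jL mul0r.
rewrite exchange_big; apply: eq_bigr => J _.
rewrite rmorph_sum mulr_suml; apply: eq_bigr => k _.
by rewrite rmorph_prod -big_split.
Qed.

Definition cell_coef (k : nat) : tens K n := [ffun L => (cell_poly L)`_k].

(** This compares coefficients in the differential equation. Hence [cell_coef k] is the [k]-th term
    of the exponential series on the highest weight vector. *)
Lemma cell_coefS k :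
  tens_act (fun k => ext_gact y) (cell_coef k) = k.+1%:R *: cell_coef k.+1.
Proof.
apply/ffunP => L; rewrite tens_act_coefE !ffunE.
have e := congr1 (fun p : {poly K} => p`_k) (deriv_cell_poly L).
rewrite coef_deriv -mulr_natl in e; apply: etrans (esym e).
rewrite coef_sum; apply: eq_bigr => J _.
by rewrite ffunE coefCM mulrC.
Qed.

Lemma cell_coef0 : cell_coef 0 = ptens (fun k => ext_hw K n k.+1).
Proof.
apply/ffunP => L; rewrite !ffunE -horner_coef0 horner_prod.
apply: eq_bigr => k _; rewrite ffunE -[RHS]/(\det (rowsub (val (L k)) (flag_mx n k.+1 K))).
rewrite -[(\det _).[0]]/(horner_eval 0 _) -det_map_mx; congr (\det _).
by apply/matrixP=> i j; rewrite !mxE /= horner_evalE !hornerE.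
Qed.

Definition cell_pt : tens K n := ptens (fun k => wedge (cell_mx k.+1 y)).

Definition cell_size := (\max_L size (cell_poly L))%N.

Lemma cell_coef_ge k : (cell_size <= k)%N -> cell_coef k = 0.
Proof.
move=> h; apply/ffunP => L; rewrite !ffunE nth_default //.
by apply: leq_trans h; apply: leq_bigmax.
Qed.

Lemma cell_ptE N : (cell_size <= N)%N -> cell_pt = \sum_(k < N) cell_coef k.
Proof.
move=> h; apply/ffunP => L; rewrite sum_ffunE ffunE.
transitivity (cell_poly L).[1].
  rewrite horner_prod; apply: eq_bigr => k _; rewrite ffunE.
  rewrite -[RHS]/(horner_eval 1 _) -det_map_mx; congr (\det _).
  by apply/matrixP=> i j; rewrite !mxE /= horner_evalE !hornerE.
rewrite (@horner_coef_wide _ N); last by apply: leq_trans h; apply: leq_bigmax.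
by apply: eq_bigr => k _; rewrite ffunE expr1n mulr1.
Qed.

Variables (Va : vectType K) (act : {linear 'M[K]_n -> 'End(Va)}) (u0 : Va).
Variable iota : {linear Va -> tens K n}.
Hypothesis iota_emb : is_ga_embedding act u0 iota.

Lemma iota_iter k : iota (iter k (act y) u0) = k`!%:R *: cell_coef k.
Proof.
case: iota_emb => _ iota_u0 iota_act; elim: k => [|k IH].
  by rewrite /= iota_u0 fact0 scale1r cell_coef0.
rewrite iterS iota_act ?IH.
  apply/ffunP => L; rewrite tens_act_coefE factS mulnC natrM -scalerA -cell_coefS.
  rewrite [RHS]ffunE tens_act_coefE scaler_sumr; apply: eq_bigr => J _.
  rewrite [X in X * _]ffunE; exact: esym (mulrA _ _ _).
by rewrite /mxtrace big1 // => i _; apply: ylow.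
Qed.

(** The terms of the exponential series are the coefficients of the polynomial curve, so their sum
    is its value at [1]. *)
Lemma iota_nilp_exp : iota (nilp_exp (act y) u0) = cell_pt.
Proof.
have [iota_inj _ _] := iota_emb.
(* The curve has finite degree, so by injectivity of [iota] some power of [act y] kills [u0]. *)
have iterN k : (\dim {:Va} <= k)%N -> iter k (act y) u0 = 0.
  apply: (@iter_nilpotent _ _ _ _ cell_size); apply: iota_inj.
  by rewrite iota_iter cell_coef_ge // scaler0 linear0.
have termE k : iota ((k`!%:R)^-1 *: iter k (act y) u0) = cell_coef k.
  by rewrite linearZ /= iota_iter scalerA mulVf ?scale1r // Num.Theory.pnatr_eq0 -lt0n fact_gt0.
(* The bound covers both truncations, and the terms beyond [\dim Va] vanish by [iterN]. *)
rewrite (@cell_ptE (maxn (\dim {:Va}).+1 cell_size)) ?leq_maxr //.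
rewrite /nilp_exp linear_sum; under eq_bigr => k _ do rewrite termE.
rewrite -(big_mkord xpredT cell_coef) -(big_mkord xpredT cell_coef).
rewrite (@big_cat_nat _ _ _ (\dim {:Va}).+1 _ (maxn _ _)) ?leq_maxl //=.
rewrite [X in _ = _ + X]big_nat [X in _ = _ + X]big1 ?addr0 // => k /andP[dk _].
by rewrite -termE iterN ?(ltnW dk) // scaler0 linear0.
Qed.

End TensorAction.

(** * Incidence as a linear condition *)

Section Projection.

Variables (R : nzRingType) (n : nat).

Definition pr_mx (d : nat) : 'M[R]_n :=
  \matrix_(i, j) ((i == j) && (i.+1 != d))%:R.

Lemma pr_mxE d p (A : 'M[R]_(n, p)) i b :
  (pr_mx d *m A) i b = (i.+1 != d)%:R * A i b.
Proof.
rewrite mxE (bigD1 i) //= !mxE eqxx /= big1 ?addr0 // => j /negPf ji.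
by rewrite mxE eq_sym ji mul0r.
Qed.

End Projection.

(** For [a < d] the columns [a] of [cell_mx d y] and [cell_mx d.+1 y] differ only in the row of
    index [d], where the second is zero and which the projection deletes. *)
Lemma pr_cell_mx (K : fieldType) n d (y : 'M[K]_n) :
  pr_mx K n d.+1 *m cell_mx d y = cell_mx d.+1 y *m flag_mx d.+1 d K.
Proof.
have flagS : flag_mx n d.+1 K *m flag_mx d.+1 d K = flag_mx n d K.
  apply/matrixP=> i a; rewrite !mxE (bigD1 (widen_ord (leqnSn d) a)) //= big1.
    by rewrite !mxE eqxx mulr1 addr0.
  by move=> c /eqP ca; rewrite !mxE [(c : nat) == a](introF eqP) ?mulr0 // => e;
    case: ca; apply: val_inj.
rewrite mulmxDl -mulmxA flagS mulmxDr; congr (_ + _); apply/matrixP=> i a.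
  rewrite pr_mxE !mxE eqSS; have [-> | _] /= := eqVneq (i : nat) d; last by rewrite mul1r.
  by rewrite gtn_eqF // mulr0.
rewrite pr_mxE !mxE mulr_sumr; apply: eq_bigr => j _; rewrite !mxE eqSS.
have [ja|_] := eqVneq (j : nat) a; last by rewrite !mulr0.
have jd : (j < d)%N by rewrite ja.
rewrite !mulr1 jd ltnS (ltnW jd) /= ltn_neqAle eq_sym.
by case: eqP => _ /=; rewrite ?mul0r ?mul1r.
Qed.

Section LinearForms.

Variables (K : fieldType) (n : nat).

Implicit Types h : forall m : 'I_n.-1, 'I_m.+1 -> 'I_n.

(** By [det_rowsub_expand], this is the linear extension to all tensors of the product of the minors
    on the rows [h m]. *)
Definition minor_form h (T : tens K n) : K :=
  \sum_(L : multi_dsub n) T L * \prod_m \det (rowsub (h m) (dsub_mx K (L m))).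

Lemma minor_form_ptens h (A : forall m : 'I_n.-1, 'M[K]_(n, m.+1)) :
  minor_form h (ptens (fun m => wedge (A m))) = \prod_m \det (rowsub (h m) (A m)).
Proof.
under [RHS]eq_bigr => m _ do rewrite det_rowsub_expand.
rewrite (prod_sum_dffun (fun (m : 'I_n.-1) (j : dsub n m.+1) =>
  \det (rowsub (h m) (dsub_mx K j)) * \det (rowsub (val j) (A m)))).
apply: eq_bigr => L _; rewrite ffunE mulrC -big_split.
by apply: eq_bigr => m _; rewrite ffunE.
Qed.

Definition upd_at h (k : 'I_n.-1) (b : nat) (i : 'I_n) (m : 'I_n.-1) (a : 'I_m.+1) :
  'I_n := if (m == k) && ((a : nat) == b) then i else h m a.
Arguments upd_at h k b i m a : clear implicits.

(* With [M = rowsub (h k) A] and [N = rowsub (h l) B], the entry [(i, b)] of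
   [\det N *: B' = B *m \adj N *m rowsub (h l) B'] for [B' = pr *m A *m \adj M]:
   it says that the columns of [B'] are combinations of those of [B], and it is
   bilinear in the maximal minors of [A] and [B], since replacing the row [b] of
   [M] by the row [i] of [A] gives the minor [(A *m \adj M) i b]. *)
Definition incidence_form h (k l : 'I_n.-1) (b : 'I_k.+1) (i : 'I_n)
    (T : tens K n) : K :=
  (i.+1 != k.+2)%:R * minor_form (upd_at h k b i) T -
  \sum_(c < l.+1) ((h l c).+1 != k.+2)%:R *
     minor_form (upd_at (upd_at h k b (h l c)) l c i) T.

Lemma incidence_form_is_linear h (k l : 'I_n.-1) (b : 'I_k.+1) i :
  linear (incidence_form h l b i : tens K n -> K^o).
Proof.
have minorP h' (c : K) T T' :
    minor_form h' (c *: T + T') = c * minor_form h' T + minor_form h' T'.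
  rewrite /minor_form mulr_sumr -big_split; apply: eq_bigr => L _ /=.
  by rewrite !ffunE mulrDl -mulrA.
move=> c T T'; rewrite /incidence_form minorP scalerBr -[RHS]/(_ * _ - _ * _ + (_ - _)).
rewrite mulrDr mulrCA -addrA -[RHS]addrA; congr (_ + _).
rewrite [RHS]addrCA; congr (_ + _); rewrite -opprD; congr (- _).
rewrite mulr_sumr -big_split; apply: eq_bigr => d _ /=.
by rewrite minorP mulrDr mulrCA.
Qed.

(** Only the factors [k] and [l] are changed, so the other minors come out as a common product, and
    each exchanged minor is an entry given by [det_rowsub_upd]. *)
Lemma incidence_form_ptens h (k l : 'I_n.-1) (b : 'I_k.+1) i
    (A : forall m : 'I_n.-1, 'M[K]_(n, m.+1)) : k != l ->
  incidence_form h l b i (ptens (fun m => wedge (A m))) =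
  (\prod_(m | (m != k) && (m != l)) \det (rowsub (h m) (A m))) *
  (let B := pr_mx K n k.+2 *m A k *m \adj (rowsub (h k) (A k)) in
   let N := rowsub (h l) (A l) in
   \det N *: B - A l *m \adj N *m rowsub (h l) B) i b.
Proof.
move=> kl; have lk : l != k by rewrite eq_sym.
have prodE (g : forall m : 'I_n.-1, 'I_m.+1 -> 'I_n) :
    (forall m, m != k -> m != l -> g m =1 h m) ->
    \prod_m \det (rowsub (g m) (A m)) = \det (rowsub (g k) (A k)) *
      (\det (rowsub (g l) (A l)) *
       \prod_(m | (m != k) && (m != l)) \det (rowsub (h m) (A m))).
  move=> gh; rewrite (bigD1 k) //= (bigD1 l) ?lk //=; congr (_ * (_ * _)).
  apply: eq_bigr => m /andP[mk ml]; congr (\det _).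
  by apply/matrixP=> a c; rewrite !mxE gh.
have rowsub_eq m (f g : 'I_m.+1 -> 'I_n) (W : 'M[K]_(n, m.+1)) :
    f =1 g -> rowsub f W = rowsub g W.
  by move=> fg; apply/matrixP=> a c; rewrite !mxE fg.
rewrite /incidence_form minor_form_ptens prodE; last first.
  by move=> m /negPf mk _ a; rewrite /upd_at mk.
have -> : \det (rowsub (upd_at h k b i k) (A k)) =
          (A k *m \adj (rowsub (h k) (A k))) i b.
  rewrite -det_rowsub_upd (rowsub_eq _ _ (upd (h k) b i)) // => a.
  by rewrite /upd_at eqxx.
have -> : rowsub (upd_at h k b i l) (A l) = rowsub (h l) (A l).
  by apply: rowsub_eq => a; rewrite /upd_at (negPf lk).
have termE (c : 'I_l.+1) :
    minor_form (upd_at (upd_at h k b (h l c)) l c i) (ptens (fun m => wedge (A m))) =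
    (A k *m \adj (rowsub (h k) (A k))) (h l c) b *
    ((A l *m \adj (rowsub (h l) (A l))) i c *
       \prod_(m | (m != k) && (m != l)) \det (rowsub (h m) (A m))).
  rewrite minor_form_ptens prodE; last first.
    by move=> m /negPf mk /negPf ml a; rewrite /upd_at mk ml.
  rewrite (rowsub_eq _ _ (upd (h k) b (h l c))); last first.
    by move=> a; rewrite /upd_at (negPf kl) eqxx.
  rewrite (rowsub_eq _ _ (upd (h l) c i)); last first.
    by move=> a; rewrite /upd_at (negPf lk) eqxx.
  by rewrite !det_rowsub_upd.
under [X in _ - X]eq_bigr => c _ do rewrite termE.
cbv zeta; rewrite -[_ *m A k *m _]mulmxA.
set P := \prod_(m | _) _; set Ek := A k *m _; set El := A l *m _.
rewrite [in RHS]mxE [in RHS]mulrDr; congr (_ + _).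
  by rewrite [in RHS]mxE pr_mxE; ring.
rewrite [in RHS]mxE mulrN; congr (- _); rewrite [in RHS]mxE mulr_sumr.
apply: eq_bigr => c _; rewrite [rowsub _ _ _ _]mxE pr_mxE; ring.
Qed.

(** If [B' = A l *m Y], then [\adj N *m rowsub (h l) B'] is [\det N *: Y], and the two terms
    cancel. *)
Lemma incidence_form_eq0 h (k l : 'I_n.-1) (b : 'I_k.+1) i
    (A : forall m : 'I_n.-1, 'M[K]_(n, m.+1)) (X : 'M[K]_(l.+1, k.+1)) : k != l ->
  pr_mx K n k.+2 *m A k = A l *m X ->
  incidence_form h l b i (ptens (fun m => wedge (A m))) = 0.
Proof.
move=> kl E; rewrite incidence_form_ptens //= E -!mulmxA -!mul_rowsub_mx.
rewrite [\adj _ *m (_ *m _)]mulmxA mul_adj_mx mul_scalar_mx -scalemxAr subrr.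
by rewrite mxE mulr0.
Qed.

(** The nonzero minors allow the common product to be cancelled and [\det N] and [\det M] to be
    inverted; multiplying by [M] undoes [\adj M]. *)
Lemma incidence_form_eq0P h (k l : 'I_n.-1) (A : forall m : 'I_n.-1, 'M[K]_(n, m.+1)) :
  k != l -> (forall m, \det (rowsub (h m) (A m)) != 0) ->
  (forall (b : 'I_k.+1) i, incidence_form h l b i (ptens (fun m => wedge (A m))) = 0) ->
  exists X : 'M[K]_(l.+1, k.+1), pr_mx K n k.+2 *m A k = A l *m X.
Proof.
move=> kl dA; set M := rowsub (h k) (A k); set N := rowsub (h l) (A l).
set B := pr_mx K n k.+2 *m A k *m \adj M.
move=> E; have {}E : \det N *: B = A l *m \adj N *m rowsub (h l) B.
  apply/eqP; rewrite -subr_eq0; apply/eqP/matrixP=> i b.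
  have := E b i; rewrite incidence_form_ptens // => /eqP; rewrite mulf_eq0.
  by case/orP=> [/prodf_eq0[m _]|/eqP-> //]; rewrite ?mxE // (negPf (dA m)).
exists ((\det N * \det M)^-1 *: (\adj N *m rowsub (h l) B *m M)).
rewrite -scalemxAr !mulmxA -E -scalemxAl -mulmxA mul_adj_mx -/M mul_mx_scalar.
by rewrite !scalerA -mulrA mulVf ?scale1r // mulf_neq0 ?dA.
Qed.

End LinearForms.

Section Closure.

Variables (K : fieldType) (W : vectType K).

(** In coordinates a linear form is a homogeneous polynomial of degree one. *)
Lemma zariski_closure_form (S : set W) (f : {linear W -> K^o}) u :
  (forall w, S w -> f w = 0) -> zariski_closure S u -> f u = 0.
Proof.
move=> fS [_ Su].
pose p : {mpoly K[\dim {:W}]} := \sum_(i < \dim {:W}) f (vbasis {:W})`_i *: 'X_i.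
have pE w : p.@[fun i => coord (vbasis {:W}) i w] = f w.
  rewrite [in RHS](coord_vbasis (memvf w)) linear_sum raddf_sum; apply: eq_bigr => i _ /=.
  by rewrite mevalZ mevalXU linearZ mulrC.
rewrite -pE; apply: (Su 1%N); last by move=> w Sw; rewrite pE fS.
by apply: rpred_sum => i _; apply: rpredZ; rewrite dhomogX /= mdeg1.
Qed.

End Closure.

Section ColumnSpaces.

Variables (K : fieldType) (n : nat).

(** The matrix whose [wedge] is [plucker d U]. *)
Definition vbasis_mx d (U : {vspace 'cV[K]_n}) : 'M[K]_(n, d) :=
  \matrix_(i, a) (vbasis U)`_a i 0.

Lemma mul_vbasis_mx d (U : {vspace 'cV[K]_n}) (x : 'cV[K]_d) :
  vbasis_mx d U *m x = \sum_a x a 0 *: (vbasis U)`_a.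
Proof.
apply/matrixP=> i j; rewrite ord1 summxE !mxE; apply: eq_bigr => a _.
by rewrite !mxE mulrC.
Qed.

Lemma memv_vbasis_mx d (U : {vspace 'cV[K]_n}) (w : 'cV[K]_n) : \dim U = d ->
  w \in U <-> exists x : 'cV[K]_d, w = vbasis_mx d U *m x.
Proof.
move=> <-; split=> [/coord_vbasis ->|[x ->]].
  exists (\col_a coord (vbasis U) a w); rewrite mul_vbasis_mx.
  by apply: eq_bigr => a _; rewrite mxE.
rewrite mul_vbasis_mx; apply: memv_suml => a _; apply: memvZ.
by apply: vbasis_mem; rewrite mem_nth ?size_tuple.
Qed.

Lemma vbasis_mx_minor d (U : {vspace 'cV[K]_n}) : \dim U = d ->
  exists f : 'I_d -> 'I_n, \det (rowsub f (vbasis_mx d U)) != 0.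
Proof.
move=> <-; suff full : row_full (vbasis_mx (\dim U) U).
  exists (fullrankfun full).
  by have := fullrowsub_unit full; rewrite unitmxE unitfE.
rewrite /row_full -mxrank_tr -/(row_free _); apply: inj_row_free => v v0.
have e := congr1 trmx v0; rewrite trmx_mul trmxK trmx0 mul_vbasis_mx in e.
apply/rowP=> a; rewrite mxE; have /freeP/(_ (v 0)) := basis_free (vbasisP U); apply.
by apply: etrans e; apply: eq_bigr => c _; rewrite mxE.
Qed.

End ColumnSpaces.

(** * Deforming an incident tuple into the orbit *)

Definition upper_mx (R : nzRingType) p q (A : 'M[R]_(p, q)) : Prop :=
  forall (i : 'I_p) (j : 'I_q), (j < i)%N -> A i j = 0.

Section TriangularFactor.

Variable K : fieldType.

Lemma col_mul p q r (A : 'M[K]_(p, q)) (B : 'M[K]_(q, r)) j :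
  col j (A *m B) = A *m col j B.
Proof. by rewrite !colE mulmxA. Qed.

(** In the rank normal form of the row [g^T], the first row of the invertible right factor is
    proportional to [g^T]. *)
Lemma complete_column p (g : 'cV[K]_p.+1) : g != 0 ->
  exists2 G : 'M[K]_p.+1, G \in unitmx & exists2 c, c != 0 & col 0 G = c *: g.
Proof.
move=> g0; have gT0 : g^T != 0 by rewrite trmx_eq0.
exists (row_ebase g^T)^T; first by rewrite unitmx_tr row_ebase_unit.
have eu := col_ebase_unit g^T; rewrite unitmxE unitfE det_mx11 in eu.
have gE : g^T = col_ebase g^T 0 0 *: (pid_mx 1 *m row_ebase g^T).
  have := mulmx_ebase g^T; rewrite rank_rV gT0 /=.
  by rewrite -mul_scalar_mx -mx11_scalar mulmxA.
exists (col_ebase g^T 0 0)^-1; first by rewrite invr_eq0.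
apply: trmx_inj; rewrite linearZ /= [X in _ *: X]gE scalerA mulVf // scale1r.
apply/rowP=> j; rewrite !mxE (bigD1 0) //= !mxE /= mul1r big1 ?addr0 // => -[[|i] ip] // _.
by rewrite !mxE /= mul0r.
Qed.

Lemma upper_block_mx p (a : 'M[K]_1) (b : 'rV[K]_p) (D : 'M[K]_p) :
  upper_mx D -> upper_mx (block_mx a b 0 D : 'M_p.+1).
Proof.
move=> Dup i j; case: (@split_ordP 1 p i) => i' ->;
  case: (@split_ordP 1 p j) => j' -> /=; rewrite ?ord1 ?add1n // ?ltnS => ji.
- by rewrite (@block_mxEdl _ 1 p 1 p) mxE.
- by rewrite (@block_mxEdr _ 1 p 1 p) Dup.
Qed.

(* The first column of [G] spans a line containing the first column of [X] and
   killed by all rows of [R] but the first: the first column of [X] itself, or,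
   if it is zero, a kernel vector of the other rows of [R]. *)
Lemma upper_factor_square p (R X : 'M[K]_p) : upper_mx (R *m X) ->
  exists G u : 'M[K]_p,
    [/\ G \in unitmx, upper_mx (R *m G), X = G *m u & upper_mx u].
Proof.
elim: p R X => [|p IH] R X RX.
  by exists 1%:M, X; split; rewrite ?unitmx1 ?mul1mx //; case.
have [g g0 [Rg [c Xg]]] : exists2 g : 'cV[K]_p.+1, g != 0 &
    (forall i : 'I_p.+1, (0 < i)%N -> (R *m g) i 0 = 0) /\ exists c, col 0 X = c *: g.
  have [X0|X0] := eqVneq (col 0 X) 0; last first.
    exists (col 0 X) => //; split; last by exists 1; rewrite scale1r.
    by move=> i i0; rewrite -col_mul mxE RX.
  pose D : 'M[K]_(p, p.+1) := @dsubmx _ 1 p _ R.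
  (* [D], the rows of [R] but the first, has fewer rows than columns. *)
  have : kermx D^T != 0.
    rewrite -mxrank_eq0 mxrank_ker -lt0n subn_gt0 mxrank_tr ltnS.
    exact: rank_leq_row.
  rewrite -nz_row_eq0 => v0.
  have vD : nz_row (kermx D^T) *m D^T = 0.
    by apply/sub_kermxP/nz_row_sub.
  exists (nz_row (kermx D^T))^T; first by rewrite trmx_eq0.
  split; last by exists 0; rewrite X0 scale0r.
  move=> i; case: (unliftP ord0 i) => [j -> _|-> //].
  have Dg : D *m (nz_row (kermx D^T))^T = 0.
    by apply: trmx_inj; rewrite trmx_mul trmxK vD trmx0.
  have := congr1 (fun M : 'cV_p => M j 0) Dg; rewrite [X in _ = X]mxE => Dgj.
  rewrite mxE -[RHS]Dgj [in RHS]mxE; apply: eq_bigr => k _.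
  by rewrite [D _ _]mxE; congr (R _ _ * _); apply: val_inj.
have [G1 G1u [e e0 G1g]] := complete_column g0.
(* In a basis starting with a multiple of [g], both [R] and [X] have a first column supported in the
   first row. *)
pose R1 : 'M[K]_(1 + p) := R *m G1; pose X1 : 'M[K]_(1 + p) := invmx G1 *m X.
have R1dl : dlsubmx R1 = 0.
  apply/matrixP=> i j; rewrite [in RHS]mxE !mxE ord1.
  have := Rg (rshift 1 i) isT; rewrite !mxE => Ri.
  transitivity (e * \sum_k R (rshift 1 i) k * g k 0); last by rewrite Ri mulr0.
  rewrite mulr_sumr; apply: eq_bigr => k _.
  have := congr1 (fun M : 'cV_p.+1 => M k 0) G1g; rewrite !mxE.
  rewrite (_ : lshift p 0 = 0); last exact: val_inj.
  by move=> ->; rewrite mulrCA.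
have X1dl : dlsubmx X1 = 0.
  apply/matrixP=> i j; rewrite [in RHS]mxE !mxE ord1.
  have gE : g = e^-1 *: col 0 G1 by rewrite G1g scalerA mulVf // scale1r.
  have : (col 0 X1) = (c * e^-1) *: col 0 1%:M.
    by rewrite col_mul Xg gE scalerA -scalemxAr -col_mul mulVmx.
  move=> /(congr1 (fun M : 'cV_p.+1 => M (rshift 1 i) 0)); rewrite !mxE mulr0.
  by rewrite (_ : lshift p 0 = 0) //; exact: val_inj.
have R1E : R1 = block_mx (ulsubmx R1) (ursubmx R1) 0 (drsubmx R1).
  by rewrite -R1dl submxK.
have X1E : X1 = block_mx (ulsubmx X1) (ursubmx X1) 0 (drsubmx X1).
  by rewrite -X1dl submxK.
have RX1 : R *m X = R1 *m X1 by rewrite /R1 /X1 mulmxA mulmxK.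
(* The lower right block of a product of block triangular matrices is the product of the lower right
   blocks, so the induction hypothesis applies to these. *)
have [|G [u [Gu RG XG uup]]] := IH (drsubmx R1) (drsubmx X1).
  move=> i j ji; have := RX (rshift 1 i) (rshift 1 j).
  rewrite /= !add1n ltnS ji RX1 R1E X1E mulmx_block => /(_ isT).
  by rewrite (@block_mxEdr _ 1 p 1 p) mul0mx add0r block_mxKdr block_mxKdr.
pose G0 : 'M[K]_(1 + p) := block_mx 1%:M 0 0 G.
pose u0 : 'M[K]_(1 + p) := block_mx (ulsubmx X1) (ursubmx X1) 0 u.
exists (G1 *m G0), u0; split.
- by rewrite unitmx_mul G1u unitmxE (@det_ublock _ 1 p) det1 mul1r -unitmxE.
- have -> : R *m (G1 *m G0) = R1 *m G0 by rewrite mulmxA.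
  rewrite R1E mulmx_block !mulmx0 !mul0mx !addr0 !add0r; exact: upper_block_mx.
- have Gu0 : G0 *m u0 = X1.
    by rewrite mulmx_block !mul0mx !mul1mx !mulmx0 !addr0 !add0r -XG -X1E.
  by rewrite -mulmxA Gu0 /X1 mulKVmx.
- exact: upper_block_mx.
Qed.

(** [X] is padded with a zero last column; triangularity asks nothing of a last column, since no row
    lies below the last one. *)
Lemma upper_factor p (R : 'M[K]_p.+1) (X : 'M[K]_(p.+1, p)) : upper_mx (R *m X) ->
  exists (G : 'M[K]_p.+1) (u : 'M[K]_(p.+1, p)),
    [/\ G \in unitmx, upper_mx (R *m G), X = G *m u & upper_mx u].
Proof.
move=> RX; pose X' : 'M[K]_p.+1 :=
  \matrix_(i, j) (if unlift ord_max j is Some a then X i a else 0).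
have X'E : colsub (lift ord_max) X' = X.
  by apply/matrixP=> i j; rewrite !mxE liftK.
have [|G [u [Gu RG XG uup]]] := @upper_factor_square _ R X'.
  move=> i j ji; case: (unliftP ord_max j) ji => [a|] -> ji.
    have -> : (R *m X') i (lift ord_max a) = (R *m X) i a.
      by rewrite -X'E mulmx_colsub [RHS]mxE.
    by rewrite RX // -(lift_max a).
  by rewrite ltnNge -ltnS ltn_ord in ji.
exists G, (colsub (lift ord_max) u); split=> //.
  by rewrite mulmx_colsub -XG X'E.
by move=> i j ji; rewrite mxE uup // lift_max.
Qed.

End TriangularFactor.

Definition upper_head (R : nzRingType) n d (A : 'M[R]_(n, d)) : Prop :=
  forall (i : 'I_n) (a : 'I_d), (a < i < d)%N -> A i a = 0.

Section AdaptedBases.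

Variables (K : fieldType) (n m : nat) (P : forall d, 'M[K]_(n, d)).
Hypothesis mn : (m < n)%N.
Hypothesis P_incident : forall d, (d < m)%N ->
  exists X : 'M_(d.+1, d), pr_mx K n d.+1 *m P d = P d.+1 *m X.

(** The first [d + 1] rows of [P d.+1 *m X *m G] are those of the projection of [P d *m G]. They are
    upper triangular: the rows before the last by hypothesis, the last because the projection kills
    it. So [upper_factor] applies. *)
Lemma adapted_step d (G : 'M[K]_d) : (d < m)%N -> upper_head (P d *m G) ->
  exists (G' : 'M[K]_d.+1) (u : 'M[K]_(d.+1, d)),
    [/\ G' \in unitmx, upper_head (P d.+1 *m G'),
        pr_mx K n d.+1 *m (P d *m G) = P d.+1 *m G' *m u & upper_mx u].
Proof.
move=> dm PG; have [X PX] := P_incident dm.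
have dn : (d.+1 <= n)%N by apply: leq_trans mn; apply: ltnW.
pose R := rowsub (widen_ord dn) (P d.+1).
have [|G' [u [Gu RG XG uup]]] := @upper_factor _ _ R (X *m G).
  move=> i j ji; rewrite mulmxA !mul_rowsub_mx -PX -mulmxA mxE pr_mxE /= eqSS.
  have [_|id] := eqVneq (i : nat) d; first by rewrite mul0r.
  by rewrite PG ?mulr0 //= ji ltn_neqAle id -ltnS ltn_ord.
exists G', u; split=> //; last by rewrite -[RHS]mulmxA -XG !mulmxA PX.
move=> i a /andP[ai id]; have := RG (Ordinal id) a ai.
by rewrite mul_rowsub_mx mxE (_ : widen_ord dn _ = i) //; apply: val_inj.
Qed.

Lemma adapted_bases :
  exists (G : forall d, 'M[K]_d) (u : forall d, 'M[K]_(d.+1, d)),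
    [/\ forall d, G d \in unitmx,
        forall d, (d <= m)%N -> upper_head (P d *m G d),
        forall d, (d < m)%N ->
          pr_mx K n d.+1 *m (P d *m G d) = P d.+1 *m G d.+1 *m u d
      & forall d, (d < m)%N -> upper_mx (u d)].
Proof.
pose S d := {G : 'M[K]_d | G \in unitmx /\ ((d <= m)%N -> upper_head (P d *m G))}.
have next d (s : S d) : exists (s' : S d.+1) (u : 'M[K]_(d.+1, d)), (d < m)%N ->
    pr_mx K n d.+1 *m (P d *m sval s) = P d.+1 *m sval s' *m u /\ upper_mx u.
  have [dm|md] : (d < m)%N \/ (m <= d)%N by case: (ltnP d m); [left | right].
  2: {
    have e1 : (1%:M : 'M[K]_d.+1) \in unitmx /\
        ((d.+1 <= m)%N -> upper_head (P d.+1 *m 1%:M)).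
      by split; [exact: unitmx1 | rewrite ltnNge md].
    (* From [m] on nothing is asked, and the identity and zero serve as default values. *)
    exists (exist _ 1%:M e1), 0 => dm; by have := leq_trans dm md; rewrite ltnn.
  }
  case: s => G [Gu PG]; have [G' [u [Gu' PG' e uup]]] := adapted_step dm (PG (ltnW dm)).
  by exists (exist _ G' (conj Gu' (fun=> PG'))), u.
have s0P : (1%:M : 'M[K]_0) \in unitmx /\ ((0 <= m)%N -> upper_head (P 0 *m 1%:M)).
  by split=> [|_ i []//]; exact: unitmx1.
(* Dependent choice: each basis is chosen adapted to the preceding one. *)
pose s := nat_rect S (exist _ 1%:M s0P) (fun d t => sval (cid (next d t))).
pose u d := sval (cid (svalP (cid (next d (s d))))).
have uP d (dm : (d < m)%N) := svalP (cid (svalP (cid (next d (s d))))) dm.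
exists (fun d => sval (s d)), u; split=> d.
- by case: (svalP (s d)).
- by case: (svalP (s d)) => _.
- by case/uP.
- by case/uP.
Qed.

End AdaptedBases.

(** * The polynomial deformation of an incident tuple *)

Section Curve.

Variables (K : fieldType) (n m : nat).
Variables (A : forall d, 'M[K]_(n, d)) (u : forall d, 'M[K]_(d.+1, d)).
Hypothesis A_head : forall d, (d <= m)%N -> upper_head (A d).
Hypothesis A_incident :
  forall d, (d < m)%N -> pr_mx K n d.+1 *m A d = A d.+1 *m u d.
Hypothesis u_upper : forall d, (d < m)%N -> upper_mx (u d).

(* [map_curve] and [curve] are the [u_d + t J] and [A_d(t)] of the introduction. *)
Definition map_curve d : 'M[{poly K}]_(d.+1, d) :=
  map_mx polyC (u d) + 'X *: flag_mx d.+1 d _.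

(* [g] is the distance [m - d], which makes the descending recursion structural. *)
Fixpoint curve_rec (g d : nat) : 'M[{poly K}]_(n, d) :=
  if g is g'.+1 then
    pr_mx _ n d.+1 *m (curve_rec g' d.+1 *m map_curve d) +
    (1%:M - pr_mx _ n d.+1) *m map_mx polyC (A d)
  else map_mx polyC (A d) + 'X *: flag_mx n d _.

Definition curve (d : nat) : 'M[{poly K}]_(n, d) := curve_rec (m - d) d.

Lemma curve_last : curve m = map_mx polyC (A m) + 'X *: flag_mx n m _.
Proof. by rewrite /curve subnn. Qed.

Lemma curve_prev d : (d < m)%N -> curve d =
  pr_mx _ n d.+1 *m (curve d.+1 *m map_curve d) +
  (1%:M - pr_mx _ n d.+1) *m map_mx polyC (A d).
Proof. by move=> dm; rewrite /curve -(subnSK dm). Qed.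

Lemma curve_ind (Q : forall d, 'M[{poly K}]_(n, d) -> Prop) :
  Q m (curve m) ->
  (forall d, (d < m)%N -> Q d.+1 (curve d.+1) -> Q d (curve d)) ->
  forall d, (d <= m)%N -> Q d (curve d).
Proof.
move=> Qm IH d /subKn <-; elim: (m - d)%N => [|k IHk]; first by rewrite subn0.
have [km|mk] := ltnP k m.
  rewrite -(subnSK km) in IHk; apply: IH => //.
  by rewrite ltn_subrL (leq_ltn_trans _ km).
have e0 : (m - k.+1 = m - k)%N by rewrite subnS (eqP mk).
by rewrite e0.
Qed.

Lemma map_curve_upper d : (d < m)%N -> upper_mx (map_curve d).
Proof.
move=> dm i j ji; rewrite !mxE u_upper // gtn_eqF // mulr0 addr0 polyC0 //.
Qed.

Lemma curve_entry d (i : 'I_n) (a : 'I_d) : (d < m)%N ->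
  curve d i a = if i == d :> nat then (A d i a)%:P
                else \sum_b curve d.+1 i b * map_curve d b a.
Proof.
move=> dm; rewrite curve_prev // mulmxBl mul1mx [LHS]mxE pr_mxE eqSS.
rewrite [X in _ + X = _]mxE [X in _ + (_ + X) = _]mxE pr_mxE eqSS !mxE.
by case: eqP => _ /=; rewrite ?mul0r ?mul1r ?subr0 ?add0r // subrr addr0.
Qed.

(** In the sum for an entry with [a < i < d], the terms with [b < i] vanish by descending induction
    and those with [b >= i] by triangularity of [map_curve]. *)
Lemma curve_head d : (d <= m)%N -> upper_head (curve d).
Proof.
apply: (curve_ind (Q := fun d => @upper_head _ n d)) => [|{}d dm IH] i a /andP[ai id].
  by rewrite curve_last !mxE A_head ?ai // gtn_eqF // mulr0 addr0 polyC0.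
rewrite curve_entry // ltn_eqF // big1 // => b _.
have [bi|ib] := ltnP b i; first by rewrite IH ?mul0r // bi ltnW.
by rewrite map_curve_upper ?mulr0 // (leq_trans ai).
Qed.

(** By triangularity a diagonal entry is the product of the diagonal entries of the factors, each of
    the form [c%:P + 'X]. The kept row [d] contains none of them, since [a < d]. *)
Lemma curve_diag d : (d <= m)%N ->
  forall (i : 'I_n) (a : 'I_d), i = a :> nat -> curve d i a != 0.
Proof.
have CX (c : K) : c%:P + 'X != 0.
  by rewrite addrC -size_poly_eq0 size_XaddC.
apply: (curve_ind (Q := fun d B =>
  forall (i : 'I_n) (a : 'I_d), i = a :> nat -> B i a != 0)) => [|{}d dm IH] i a ia.
  by rewrite curve_last !mxE ia eqxx mulr1 CX.
have ad := ltn_ord a.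
rewrite curve_entry // ia ltn_eqF // (bigD1 (widen_ord (leqnSn d) a)) //=.
rewrite big1 => [|b ba].
  rewrite addr0 mulf_neq0 ?IH // !mxE eqxx mulr1; exact: CX.
have [bi|ib] := ltnP b a.
  by rewrite curve_head ?mul0r // ia bi ltnS ltnW.
rewrite map_curve_upper ?mulr0 // ltn_neqAle ib andbT.
by apply: contraNneq ba => e; apply/eqP/val_inj.
Qed.

(** Outside the row of index [d] this is the construction. In that row the left side is zero, and
    triangularity of both factors makes the right side zero too. *)
Lemma curve_incident d : (d < m)%N ->
  pr_mx _ n d.+1 *m curve d = curve d.+1 *m map_curve d.
Proof.
move=> dm; apply/matrixP=> i a; rewrite pr_mxE curve_entry // eqSS [RHS]mxE.
case: eqP => [id|_]; last by rewrite mul1r.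
rewrite mul0r big1 // => b _.
have [bi|ib] := ltnP b i; first by rewrite curve_head ?mul0r // bi id ltnSn.
by rewrite map_curve_upper ?mulr0 // (leq_trans _ ib) // id.
Qed.

Lemma curve0 d : (d <= m)%N -> map_mx (horner_eval 0) (curve d) = A d.
Proof.
apply: (curve_ind (Q := fun d B => map_mx (horner_eval 0) B = A d)) => [|{}d dm IH].
  by apply/matrixP=> i a; rewrite curve_last !mxE /= horner_evalE !hornerE.
apply/matrixP=> i a; rewrite mxE curve_entry //; case: eqP => id.
  by rewrite /= horner_evalE hornerE.
have := congr1 (fun M : 'M_(n, d) => M i a) (A_incident dm).
rewrite pr_mxE eqSS (introF eqP id) mul1r => ->; rewrite mxE rmorph_sum.
apply: eq_bigr => b _; rewrite rmorphM -[A d.+1]IH; congr (_ * _); first by rewrite mxE.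
by rewrite !mxE /= horner_evalE !hornerE.
Qed.

End Curve.

(** * Recognizing tuples in the orbit *)

Section Cell.

Variables (K : fieldType) (n m : nat).
Variables (B : forall d, 'M[K]_(n, d)) (v : forall d, 'M[K]_(d.+1, d)).
Hypothesis mn : (m < n)%N.
Hypothesis B_head : forall d, (d <= m)%N -> upper_head (B d).
Hypothesis B_diag : forall d, (d <= m)%N ->
  forall (i : 'I_n) (a : 'I_d), i = a :> nat -> B d i a != 0.
Hypothesis B_incident :
  forall d, (d < m)%N -> pr_mx K n d.+1 *m B d = B d.+1 *m v d.

(** The square matrix of the first [d] rows of [B d]. *)
Let T d : 'M[K]_d := (flag_mx n d K)^T *m B d.

Lemma head_mx_entry d p (C : 'M[K]_(n, p)) (i : 'I_n) (c : 'I_d) (a : 'I_p) :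
  i = c :> nat -> ((flag_mx n d K)^T *m C) c a = C i a.
Proof.
move=> ic; rewrite mxE (bigD1 i) //= !mxE ic eqxx mul1r big1 ?addr0 // => j ji.
rewrite !mxE (introF eqP) ?mul0r // => jc; case/eqP: ji; apply: val_inj.
by rewrite /= jc.
Qed.

Lemma head_mx_unit d : (d <= m)%N -> T d \in unitmx.
Proof.
move=> dm; have dn : (d <= n)%N by apply: leq_trans (ltnW mn).
have TE (c a : 'I_d) : T d c a = B d (widen_ord dn c) a by apply: head_mx_entry.
rewrite -unitmx_tr unitmxE unitfE det_trig.
  by apply/prodf_neq0 => a _; rewrite mxE TE B_diag.
by apply/is_trig_mxP=> a c ac; rewrite mxE TE B_head //= ac ltn_ord.
Qed.

Let E d : 'M[K]_(n, d) := B d *m invmx (T d).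

Lemma cell_frame_head d : (d <= m)%N -> (flag_mx n d K)^T *m E d = 1%:M.
Proof. by move=> dm; rewrite mulmxA mulmxV // head_mx_unit. Qed.

(** The head of [E d.+1] is the identity, so the transition matrix can be read off from the first
    [d + 1] rows of the projected [E d]. *)
Lemma cell_frame_incident d : (d < m)%N ->
  pr_mx K n d.+1 *m E d = E d.+1 *m flag_mx d.+1 d K.
Proof.
move=> dm; pose w := T d.+1 *m v d *m invmx (T d).
have Ew : pr_mx K n d.+1 *m E d = E d.+1 *m w.
  rewrite mulmxA B_incident // /w -[T d.+1 *m _ *m _]mulmxA.
  by rewrite [RHS]mulmxA mulmxKV ?mulmxA // head_mx_unit.
suff -> : flag_mx d.+1 d K = w by [].
have dn : (d < n)%N by apply: ltn_trans mn.
have := congr1 (mulmx (flag_mx n d.+1 K)^T) Ew.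
rewrite [in X in _ = X]mulmxA cell_frame_head // mul1mx => <-.
apply/matrixP=> c a; rewrite [RHS](@head_mx_entry _ _ _ (widen_ord dn c)) // pr_mxE mxE eqSS /=.
have [cd|cd] := eqVneq (c : nat) d; first by rewrite mul0r cd gtn_eqF.
have cd' : (c < d)%N by rewrite ltn_neqAle cd -ltnS ltn_ord.
rewrite mul1r -(@head_mx_entry _ _ _ _ (Ordinal cd')) // cell_frame_head ?(ltnW dm) //.
by rewrite mxE.
Qed.

(** By [cell_frame_incident], the entries of [E d] in the rows from [d] on do not depend on [d], so
    one matrix [y] gives all the frames. *)
Lemma in_cell : exists y : 'M[K]_n, strictly_lower y /\
  forall d, (d <= m)%N -> exists2 G, G \in unitmx & B d = cell_mx d y *m G.
Proof.
(* The column [j] first occurs in [E j.+1], as the last one. *)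
pose f (i : 'I_n) (j : nat) : K := E j.+1 i ord_max.
pose y : 'M[K]_n := \matrix_(i, j) (if (j < i)%N then f i j else 0).
exists y; split=> [i j ij|d dm]; first by rewrite mxE ltnNge ij.
exists (T d); first exact: head_mx_unit.
rewrite -[LHS](mulmxKV (head_mx_unit dm)) -/(E d); congr (_ *m _).
have Ef : forall d, (d <= m)%N ->
    forall (i : 'I_n) (a : 'I_d), (d <= i)%N -> E d i a = f i a.
  elim=> [|k IH] km i a ki; first by case: a.
  case: (unliftP ord_max a) => [c|] ->; last by [].
  rewrite lift_max -IH ?(ltnW km) // ?(ltnW ki) //.
  have := congr1 (fun M : 'M_(n, k) => M i c) (cell_frame_incident km).
  rewrite pr_mxE eqSS gtn_eqF // mul1r => ->.
  rewrite [RHS]mxE (bigD1 (lift ord_max c)) //= [flag_mx _ _ _ _ _]mxE lift_max eqxx.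
  rewrite mulr1 big1 ?addr0 // => b bc.
  rewrite [flag_mx _ _ _ _ _]mxE (introF eqP) ?mulr0 // => bc'; case/eqP: bc.
  by apply: ord_inj; rewrite lift_max.
apply/matrixP=> i a; rewrite [RHS]mxE [flag_mx _ _ _ _ _]mxE [(cut _ _ *m _) _ _]mxE.
have an : (a < n)%N by apply: leq_trans (ltn_ord a) _; apply: leq_trans dm (ltnW mn).
rewrite (bigD1 (Ordinal an)) //= [flag_mx _ _ _ _ _]mxE /= eqxx mulr1.
rewrite big1 ?addr0; last first.
  move=> j ja; rewrite [flag_mx _ _ _ _ _]mxE (introF eqP) ?mulr0 // => e.
  by case/eqP: ja; apply: val_inj.
rewrite [cut _ _ _ _]mxE /= ltn_ord /=.
have [di|id] := leqP d i.
  have ai : (a < i)%N by apply: leq_trans di.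
  by rewrite gtn_eqF // add0r [y _ _]mxE /= ai Ef.
rewrite addr0 -(@head_mx_entry _ _ _ _ (Ordinal id)) // cell_frame_head //.
by rewrite mxE.
Qed.

End Cell.

(** * The closure *)

Lemma wedge_mul (K : fieldType) n d (W : 'M[K]_(n, d)) (G : 'M[K]_d) :
  wedge (W *m G) = \det G *: wedge W.
Proof.
by apply/ffunP=> J; rewrite !ffunE -mul_rowsub_mx det_mulmx [LHS]mulrC.
Qed.

Lemma ptensZ (K : fieldType) n (c : 'I_n.-1 -> K)
    (t : forall k : 'I_n.-1, ext K n k.+1) :
  ptens (fun k => c k *: t k) = (\prod_k c k) *: ptens t.
Proof.
apply/ffunP=> L; rewrite !ffunE [RHS](esym (big_split _ _ _ _ _)).
by apply: eq_bigr => k _; rewrite ffunE.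
Qed.

(** [D * p] vanishes everywhere, in particular at as many natural numbers as its size, and these are
    distinct in characteristic zero. *)
Lemma poly_eq0_generic (K : numFieldType) (D p : {poly K}) : D != 0 ->
  (forall t, D.[t] != 0 -> p.[t] = 0) -> p = 0.
Proof.
move=> D0 pD; apply/eqP; have : D * p == 0.
  apply: contraT => Dp0.
  have := @max_poly_roots _ _ [seq i%:R | i <- iota 0 (size (D * p))] Dp0.
  rewrite size_map size_iota ltnn map_inj_uniq ?iota_uniq; last first.
    by move=> i j /eqP; rewrite Num.Theory.eqr_nat => /eqP.
  move=> -> //; apply/allP=> t _; rewrite /root hornerM.
  by have [->|/pD->] := eqVneq D.[t] 0; rewrite ?mul0r ?mulr0.
by rewrite mulf_eq0 (negPf D0).
Qed.

Lemma linear_tensE (K : fieldType) n (W : lmodType K) (f : {linear tens K n -> W}) T :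
  f T = \sum_L T L *: f [ffun L' => (L' == L)%:R].
Proof.
have {1}-> : T = \sum_L T L *: [ffun L' => (L' == L)%:R] :> tens K n.
  apply/ffunP=> L; rewrite sum_ffunE (bigD1 L) //= !ffunE eqxx big1 ?addr0.
    by rewrite [RHS]mulr1.
  by move=> M /negPf ML; rewrite !ffunE eq_sym ML; apply: mulr0.
by rewrite linear_sum; apply: eq_bigr => L _; rewrite linearZ.
Qed.

Section PolynomialCurve.

Variables (K : numFieldType) (n : nat).
Variables (Va : vectType K) (iota : {linear Va -> tens K n}).
Hypothesis iota_inj : injective iota.

(** An equation holding along a polynomial curve for generic [t] is a polynomial identity in [t], so
    it persists at [t = 0]. This applies to the linear equations of the image of [iota] and to the
    homogeneous equations of [S]. *)
Lemma curve_limit (S : set Va) (D : {poly K}) (T : multi_dsub n -> {poly K}) :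
  D != 0 ->
  (forall t, D.[t] != 0 ->
     exists2 w, S w & iota w = [ffun L => (T L).[t]]) ->
  exists u, iota u = [ffun L => (T L).[0]] /\ (u != 0 -> zariski_closure S u).
Proof.
move=> D0 TS; pose Tt t : tens K n := [ffun L => (T L).[t]].
pose pi : 'Hom(tens K n, Va) := ((linfun iota)^-1)%VF.
have piK w : pi (iota w) = w.
  rewrite -[iota w](lfunE iota) lker0_lfunK //.
  by apply/lker0P => a b; rewrite !lfunE; apply: iota_inj.
have lin0 (f : {linear tens K n -> K^o}) :
    (forall t, D.[t] != 0 -> f (Tt t) = 0) -> f (Tt 0) = 0.
  pose p := \sum_L (f [ffun L' => (L' == L)%:R])%:P * T L.
  have pE t : f (Tt t) = p.[t].
    rewrite linear_tensE horner_sum; apply: eq_bigr => L _.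
    by rewrite ffunE hornerM hornerC mulrC.
  move=> fD; rewrite pE (@poly_eq0_generic _ D p) ?horner0 // => t /fD.
  by rewrite pE.
exists (pi (Tt 0)); split.
  (* The coordinates of [iota (pi X) - X] are linear forms in [X] that vanish on the image of
     [iota]. *)
  apply/eqP; rewrite -subr_eq0; apply/eqP/ffunP => L; rewrite [RHS]ffunE.
  have flin : linear (fun X : tens K n => (iota (pi X) - X) L : K^o).
    move=> c X Y; have -> : iota (pi (c *: X + Y)) - (c *: X + Y) =
        c *: (iota (pi X) - X) + (iota (pi Y) - Y).
      by rewrite !linearP addrACA -scalerDr.
    by rewrite !ffunE.
  pose F := GRing.isLinear.Build _ _ _ _ _ flin.
  pose f : {linear tens K n -> K^o} :=
    HB.pack (fun X : tens K n => (iota (pi X) - X) L : K^o) F.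
  apply: (lin0 f) => t /TS[w _ wE]; rewrite /= /Tt -wE piK subrr ffunE //.
move=> u0; split=> // e p _ pS.
pose Q i := \sum_L (coord (vbasis {:Va}) i (pi [ffun L' => (L' == L)%:R]))%:P * T L.
have QE i t : coord (vbasis {:Va}) i (pi (Tt t)) = (Q i).[t].
  rewrite (linear_tensE pi) linear_sum horner_sum; apply: eq_bigr => L _.
  by rewrite linearZ ffunE hornerM hornerC mulrC.
pose q := \sum_(m <- msupp p) (p@_m)%:P * \prod_i Q i ^+ m i.
have qE t : p.@[fun i => coord (vbasis {:Va}) i (pi (Tt t))] = q.[t].
  rewrite mevalE horner_sum; apply: eq_bigr => m _.
  rewrite hornerM hornerC horner_prod; congr (_ * _); apply: eq_bigr => i _.
  by rewrite QE horner_exp.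
rewrite qE (@poly_eq0_generic _ D q) ?horner0 // => t /TS[w Sw wE].
by rewrite -qE /Tt -wE piK pS.
Qed.

End PolynomialCurve.

(** * The two inclusions *)

Section Main.

Variables (K : numFieldType) (n : nat).
Variables (Va : vectType K) (act : {linear 'M[K]_n -> 'End(Va)}) (u0 : Va).
Variable iota : {linear Va -> tens K n}.
Hypothesis iota_emb : is_ga_embedding act u0 iota.

Implicit Types U : 'I_n.-1 -> {vspace 'cV[K]_n}.

Lemma pr_limgP d e p (U W : {vspace 'cV[K]_n}) : \dim U = d -> \dim W = e ->
  (pr K n p @: U <= W)%VS <->
  exists X : 'M_(e, d), pr_mx K n p *m vbasis_mx d U = vbasis_mx e W *m X.
Proof.
move=> Ud We; split=> [/subvP UW|[X UX]]; last first.
  apply/subvP=> _ /memv_imgP[w wU ->]; rewrite lfunE /=.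
  have [x ->] := (memv_vbasis_mx w Ud).1 wU.
  by apply/(memv_vbasis_mx _ We); exists (X *m x); rewrite !mulmxA -UX.
have colP a : exists x, pr_mx K n p *m col a (vbasis_mx d U) = vbasis_mx e W *m x.
  apply/(memv_vbasis_mx _ We)/UW; rewrite -[_ *m _]/(mulmx _ _) -(lfunE (mulmx (pr_mx K n p))).
  apply/memv_img/(memv_vbasis_mx _ Ud); exists (delta_mx a 0); exact: colE.
have [x xP] := choice colP.
exists (\matrix_(i, a) x a i 0); apply/matrixP=> i a.
have := congr1 (fun M : 'cV_n => M i 0) (xP a); rewrite -col_mul !mxE => ->.
by apply: eq_bigr => c _; rewrite mxE.
Qed.

Lemma vbasis_mx_minors U : (forall k, \dim (U k) = k.+1) ->
  exists h : forall m : 'I_n.-1, 'I_m.+1 -> 'I_n,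
    forall m, \det (rowsub (h m) (vbasis_mx m.+1 (U m))) != 0.
Proof.
move=> Ud; exists (fun m => sval (cid (vbasis_mx_minor (Ud m)))) => m.
exact: svalP (cid (vbasis_mx_minor (Ud m))).
Qed.

Lemma flag_image_incident U : flag_image act u0 iota U ->
  forall k l : 'I_n.-1, (l : nat) = k.+1 -> (pr K n k.+2 @: U k <= U l)%VS.
Proof.
case=> Ud [u uF [c c0 uE]] k l lk.
have kl : k != l by apply/eqP=> e; move: lk; rewrite e => /n_Sn.
apply/(pr_limgP _ (Ud k) (Ud l)).
(* The forms are chosen for this [U], with rows whose minors do not vanish on it. *)
have [h hU] := vbasis_mx_minors Ud.
apply: (incidence_form_eq0P (A := fun m => vbasis_mx m.+1 (U m)) kl hU) => b i.
have flin : linear (fun w : Va => incidence_form h l b i (iota w) : K^o).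
  by move=> a w w'; rewrite linearP; apply: incidence_form_is_linear.
pose f : {linear Va -> K^o} :=
  HB.pack (fun w : Va => incidence_form h l b i (iota w) : K^o)
    (GRing.isLinear.Build _ _ _ _ _ flin).
have formZ a T : incidence_form h l b i (a *: T) = a * incidence_form h l b i T.
  have := incidence_form_is_linear h l b i a T 0; rewrite addr0 => ->.
  have := incidence_form_is_linear h l b i (-1) T T.
  by rewrite scaleN1r addNr => ->; rewrite scaleN1r addNr addr0.
have : f u = 0.
  apply: zariski_closure_form uF => w [y [ylow [a a0 ->]]].
  rewrite /= linearZ formZ (iota_nilp_exp ylow iota_emb).
  suff [X XE] : exists X, pr_mx K n k.+2 *m cell_mx k.+1 y = cell_mx l.+1 y *m X.
    by rewrite (incidence_form_eq0 (A := fun m => cell_mx m.+1 y) _ _ _ kl XE) mulr0.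
  by rewrite lk; eexists; apply: pr_cell_mx.
rewrite /= uE formZ => /eqP; rewrite mulf_eq0 (negPf c0) => /eqP.
by [].
Qed.

Lemma incident_flag_image U : (1 < n)%N -> (forall k, \dim (U k) = k.+1) ->
  (forall k l : 'I_n.-1, (l : nat) = k.+1 -> (pr K n k.+2 @: U k <= U l)%VS) ->
  flag_image act u0 iota U.
Proof.
move=> n_gt1 Ud U_incident; split=> //.
have mn : (n.-1 < n)%N by case: n n_gt1.
(* [U] is reindexed by all natural numbers: the sum is [U k] at [d = k + 1] and zero at [d = 0]. *)
pose V d := (\sum_(j < n.-1 | j.+1 == d) U j)%VS.
have VU (k : 'I_n.-1) : V k.+1 = U k.
  by rewrite /V (big_pred1 k) // => j; rewrite eqSS.
pose P d := vbasis_mx d (V d).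
have P_incident d : (d < n.-1)%N ->
    exists X : 'M_(d.+1, d), pr_mx K n d.+1 *m P d = P d.+1 *m X.
  case: d => [|d] dm; first by exists 0; apply/matrixP=> i [].
  have := U_incident (Ordinal (ltnW dm)) (Ordinal dm) erefl.
  by move/(pr_limgP _ (Ud _) (Ud _)); rewrite -!VU.
have [G [u [Gu PG G_incident u_upper]]] := adapted_bases mn P_incident.
pose B := curve n.-1 (fun d => P d *m G d) u.
(* [D] collects the diagonal entries of all the [B d], so [D.[t] != 0] is the diagonal hypothesis of
   [in_cell] at [t]. *)
pose D := \prod_(d < n) \prod_(i < n) \prod_(a < d | i == a :> nat) B d i a.
have D0 : D != 0.
  apply/prodf_neq0 => d _; apply/prodf_neq0 => i _; apply/prodf_neq0 => a /eqP ia.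
  by apply: curve_diag => //; rewrite -ltnS prednK // ltnW.
pose T (L : multi_dsub n) := \prod_k \det (rowsub (val (L k)) (B k.+1)).
have TE t : [ffun L => (T L).[t]] =
    ptens (fun k => wedge (map_mx (horner_eval t) (B k.+1))) :> tens K n.
  apply/ffunP=> L; rewrite !ffunE horner_prod; apply: eq_bigr => k _.
  by rewrite ffunE -map_mxsub det_map_mx.
have [iota_inj _ _] := iota_emb.
have [|w [wE w_closure]] := @curve_limit _ _ _ _ iota_inj (Ga_orbit act u0) D T D0.
  move=> t Dt.
  have [d dm i a iad|d dm i a ia|d dm|y [ylow yE]] := @in_cell K n n.-1
      (fun d => map_mx (horner_eval t) (B d))
      (fun d => map_mx (horner_eval t) (map_curve u d)) mn.
  - by rewrite mxE (curve_head PG u_upper dm iad) rmorph0.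
  - rewrite mxE; apply: contraNneq Dt => Bt.
    have dn : (d < n)%N by apply: leq_ltn_trans mn.
    rewrite /D (bigD1 (Ordinal dn)) //= (bigD1 i) //= (bigD1 a) //=; last exact/eqP.
    by rewrite !hornerM -[_.[t]]/(horner_eval t _) Bt !mul0r.
  - have := curve_incident PG u_upper dm.
    move=> /(congr1 (map_mx (horner_eval t))); rewrite !map_mxM => <-; congr (_ *m _).
    by apply/matrixP=> i j; rewrite !mxE rmorph_nat.
  have g (k : 'I_n.-1) := cid2 (yE k.+1 (ltn_ord k)).
  (* The bases on the curve differ from the cell frames by invertible matrices, whose determinants
     go into the scalar allowed in the orbit. *)
  exists ((\prod_k \det (s2val (g k))) *: nilp_exp (act y) u0).
    exists y; split=> //; exists (\prod_k \det (s2val (g k))) => //.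
    by apply/prodf_neq0 => k _; case: (g k) => H /=; rewrite unitmxE unitfE.
  rewrite TE linearZ /= (iota_nilp_exp ylow iota_emb) -ptensZ.
  congr (ptens _); apply: functional_extensionality_dep => k.
  by case: (g k) => H /= _ ->; rewrite wedge_mul.
have w_plucker : iota w = (\prod_(k < n.-1) \det (G k.+1)) *:
    ptens (fun k => plucker k.+1 (U k)).
  rewrite wE TE -ptensZ; congr (ptens _); apply: functional_extensionality_dep => k.
  by rewrite (curve0 G_incident) // wedge_mul /P VU.
have detG : \prod_(k < n.-1) \det (G k.+1) != 0.
  by apply/prodf_neq0 => k _; rewrite -unitfE -unitmxE.
exists w; last by exists (\prod_(k < n.-1) \det (G k.+1)).
(* [w] is nonzero because [minor_form h], with [h] selecting nonzero minors of [U], does not vanish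
   on the tensor of Pluecker vectors. *)
apply: w_closure; apply/eqP => w0.
have [h hU] := vbasis_mx_minors Ud.
have : \prod_m \det (rowsub (h m) (vbasis_mx m.+1 (U m))) != 0.
  by apply/prodf_neq0 => m _; apply: hU.
rewrite -minor_form_ptens -[ptens _](scalerK detG) -w_plucker w0 linear0 scaler0.
by rewrite /minor_form big1 ?eqxx // => L _; rewrite ffunE mul0r.
Qed.

End Main.

Theorem theorem0p1 (R : realType) (n : nat) (n_ge2 : (2 <= n)%N)
    (V : vectType R[i]) (rho : {linear 'M[R[i]]_n -> 'End(V)}) (v : V)
    (V_irr : irreducible_highest_weight rho v (@complete_weight R[i] n))
    (Va : vectType R[i]) (cls : nat -> 'Hom(V, Va))
    (act : {linear 'M[R[i]]_n -> 'End(Va)})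
    (Va_gr : is_pbw_degeneration rho v cls act)
    (iota : {linear Va -> tens R[i] n})
    (iota_emb : is_ga_embedding act (cls 0%N v) iota) :
  flag_image act (cls 0%N v) iota =
  [set U : 'I_n.-1 -> {vspace 'cV[R[i]]_n} |
     (forall k : 'I_n.-1, \dim (U k) = k.+1) /\
     (forall k l : 'I_n.-1, (l : nat) = k.+1 ->
        (pr R[i] n k.+2 @: U k <= U l)%VS)]%classic.
Proof.
apply/seteqP; split=> [U U_flag|U [Ud U_incident]].
  by split; [case: U_flag | exact: flag_image_incident iota_emb U U_flag].
exact: incident_flag_image iota_emb U n_ge2 Ud U_incident.
Qed.
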